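(* Let $A$ be a finite-dimensional braided algebra over a field $k$ with basis $\{e_i\}$, structure constants $e_ie_j=\sum_kc_{ij}{}^ke_k$, and braiding $\Psi(e_i\otimes e_j)=\sum_{a,b}e_b\otimes e_a\,R^a{}_i{}^b{}_j$ defined by an invertible $R$-matrix $R$. Then the algebra $M_1(R,A)$ generated by $1$ and $t^i{}_j$ with the relations (summation over repeated indices) $$R^i{}_a{}^j{}_b\,t^a{}_kt^b{}_l=t^j{}_bt^i{}_a\,R^a{}_k{}^b{}_l,\qquad c_{ij}{}^at^k{}_a=c_{ab}{}^kt^a{}_it^b{}_j$$ and the matrix coalgebra structure $\Delta t^i{}_j=t^i{}_a\otimes t^a{}_j$, $\epsilon(t^i{}_j)=\delta^i{}_j$, is a dual quasitriangular bialgebra.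
   Context: An $R$-matrix is $R\in M_n\otimes M_n$ ($n=\dim A$, $M_n$ the $n\times n$ matrices over $k$; entries $R^i{}_j{}^k{}_l$, where $i,j$ are row and column indices in the first factor and $k,l$ in the second) obeying the quantum Yang–Baxter equations $R_{12}R_{13}R_{23}=R_{23}R_{13}R_{12}$. That $A$ is a braided algebra with braiding defined by $R$ means that $A$ is an associative algebra, $\Psi:A\otimes A\to A\otimes A$ obeys the braid relations, and the product is functorial with respect to $\Psi$, i.e. $\Psi(ab\otimes c)=(\mathrm{id}\otimes\cdot)(\Psi\otimes\mathrm{id})(\mathrm{id}\otimes\Psi)(a\otimes b\otimes c)$ and $\Psi(a\otimes bc)=(\cdot\otimes\mathrm{id})(\mathrm{id}\otimes\Psi)(\Psi\otimes\mathrm{id})(a\otimes b\otimes c)$ for all $a,b,c\in A$; in components the functoriality reads $$c_{ij}{}^aR^k{}_a{}^m{}_n=c_{ab}{}^kR^a{}_i{}^m{}_cR^b{}_j{}^c{}_n,\qquad c_{jk}{}^aR^m{}_n{}^i{}_a=c_{ab}{}^iR^m{}_c{}^b{}_kR^c{}_n{}^a{}_j .$$ A bialgebra $M$ is called dual quasitriangular if there exists a linear map $\mathcal{R}:M\otimes M\to k$ such that for all $a,b,c\in M$ $$\mathcal{R}(ab,c)=\mathcal{R}(a,c_{(1)})\mathcal{R}(b,c_{(2)}),\quad \mathcal{R}(a,bc)=\mathcal{R}(a_{(1)},c)\mathcal{R}(a_{(2)},b),\quad b_{(1)}a_{(1)}\mathcal{R}(a_{(2)},b_{(2)})=\mathcal{R}(a_{(1)},b_{(1)})a_{(2)}b_{(2)},$$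 where $\Delta a=a_{(1)}\otimes a_{(2)}$ denotes the coproduct. *)

(* Defs.v *)
From HB Require Import structures.
From mathcomp Require Import all_boot all_order all_algebra.
From mathcomp Require Import generic_quotient ring_quotient sesquilinear.
From mathcomp Require Import boolp.
From mathcomp Require Import finmap monalg.

Set Implicit Arguments.
Unset Strict Implicit.
Unset Printing Implicit Defensive.

Import GRing.Theory Quotient.

Local Open Scope ring_scope.
Local Open Scope quotient_scope.

Section QuotientModule.
Variables (k : fieldType) (V : lmodType k) (S : V -> Prop).

Inductive in_span : V -> Prop :=
| in_span0 : in_span 0
| in_spanD a u v : S u -> in_span v -> in_span (a *: u + v).

Definition span_pred : {pred V} := fun v => `[< in_span v >].

Lemma in_spanZD a u v : in_span u -> in_span v -> in_span (a *: u + v).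
Proof.
move=> + hv; elim=> [|b x y Sx _ IH]; first by rewrite scaler0 add0r.
by rewrite scalerDr scalerA -addrA; apply: in_spanD.
Qed.

Lemma span_zmod_closed : zmod_closed span_pred.
Proof.
split=> [|u v /asboolP hu /asboolP hv]; apply/asboolP; first exact: in_span0.
by rewrite addrC -scaleN1r; apply: in_spanZD.
Qed.

HB.instance Definition _ := GRing.isZmodClosed.Build V span_pred
  span_zmod_closed.

Lemma spanZ a u : u \in span_pred -> a *: u \in span_pred.
Proof.
by move=> /asboolP hu; apply/asboolP; rewrite -[X in in_span X]addr0;
   apply: in_spanZD => //; apply: in_span0.
Qed.

Lemma span_gen u : S u -> u \in span_pred.
Proof.
move=> Su; apply/asboolP; rewrite -[u]addr0 -[X in X + _]scale1r.
by apply: in_spanD => //; apply: in_span0.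
Qed.

(* V modulo the linear span of S *)
Definition quot_mod := Quotient.quot (span_pred : zmodClosed V).
HB.instance Definition _ := GRing.Zmodule.on quot_mod.
HB.instance Definition _ := EqQuotient.on quot_mod.
HB.instance Definition _ := ZmodQuotient.on quot_mod.

Definition quot_proj (v : V) : quot_mod := \pi v.

Lemma quot_projP u v : reflect (quot_proj u = quot_proj v) (u - v \in span_pred).
Proof. by rewrite (Quotient.idealrBE span_pred); apply: eqP. Qed.

Lemma quot_projK (x : quot_mod) : quot_proj (repr x) = x.
Proof. exact: reprK. Qed.

Lemma quot_projD u v : quot_proj (u + v) = quot_proj u + quot_proj v.
Proof. exact: (raddfD (\pi_quot_mod)). Qed.

Definition quot_scale a (x : quot_mod) : quot_mod := quot_proj (a *: repr x).

Lemma quot_projZ a u : quot_proj (a *: u) = quot_scale a (quot_proj u).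
Proof.
apply/quot_projP; rewrite -scalerBr; apply: spanZ.
by apply/quot_projP; rewrite quot_projK.
Qed.

Fact quot_scaleA a b x :
  quot_scale a (quot_scale b x) = quot_scale (a * b) x.
Proof. by rewrite -[x]quot_projK -!quot_projZ scalerA. Qed.

Fact quot_scale1 : left_id 1 quot_scale.
Proof. by move=> x; rewrite -[x]quot_projK -quot_projZ scale1r. Qed.

Fact quot_scaleDr : right_distributive quot_scale +%R.
Proof.
move=> a x y; rewrite -[x]quot_projK -[y]quot_projK -quot_projD -!quot_projZ.
by rewrite scalerDr quot_projD.
Qed.

Fact quot_scaleDl x : {morph quot_scale^~ x : a b / a + b}.
Proof.
by move=> a b; rewrite -[x]quot_projK -!quot_projZ scalerDl quot_projD.
Qed.

HB.instance Definition _ := GRing.Zmodule_isLmodule.Build k quot_mod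
  quot_scaleA quot_scale1 quot_scaleDr quot_scaleDl.

Lemma quot_projZE a u : quot_proj (a *: u) = a *: quot_proj u.
Proof. exact: quot_projZ. Qed.

Fact quot_proj_is_linear : linear quot_proj.
Proof. by move=> a u v; rewrite quot_projD quot_projZ. Qed.

HB.instance Definition _ := GRing.isLinear.Build k V quot_mod _ quot_proj
  quot_proj_is_linear.

End QuotientModule.

Section Tensor.
Variables (k : fieldType) (V W : lmodType k).

Inductive tensor_rel : {malg k[(V * W)%type]} -> Prop :=
| tensor_rel_l a v v' w :
    tensor_rel (<< (a *: v + v', w) >> - (a *: << (v, w) >> + << (v', w) >>))
| tensor_rel_r a v w w' :
    tensor_rel (<< (v, a *: w + w') >> - (a *: << (v, w) >> + << (v, w') >>)).

(* V (x) W: the free module on V * W modulo bilinearity *)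
Definition tensor := quot_mod tensor_rel.
HB.instance Definition _ := GRing.Lmodule.on tensor.
HB.instance Definition _ := EqQuotient.on tensor.

Definition tens (v : V) (w : W) : tensor := quot_proj tensor_rel << (v, w) >>.

Lemma tens_bilinear : bilinear_for *:%R *:%R tens.
Proof.
split=> [w a v v'|v a w w'] /=.
  rewrite /tens -(quot_proj_is_linear _ a << (v, w) >> << (v', w) >>).
  exact/quot_projP/span_gen/tensor_rel_l.
rewrite /tens -(quot_proj_is_linear _ a << (v, w) >> << (v, w') >>).
exact/quot_projP/span_gen/tensor_rel_r.
Qed.

Section Lift.
Variables (U : lmodType k) (f : V -> W -> U).

(* The linear map induced by f on V (x) W, computed on a representative; it is
   the expected one (well defined and linear) as soon as f is bilinear, see
   tlift_linear and tliftE. *)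
Definition malg_lift (g : {malg k[(V * W)%type]}) : U :=
  \sum_(p <- msupp g) g@_p *: f p.1 p.2.

Definition tlift (x : tensor) : U := malg_lift (repr x).

Lemma malg_liftEw (d : {fset (V * W)}%fset) g : (msupp g `<=` d)%fset ->
  malg_lift g = \sum_(p <- d) g@_p *: f p.1 p.2.
Proof.
move=> le; rewrite [LHS](big_fset_incl _ le) => //= x xd /mcoeff_outdom ->.
by rewrite scale0r.
Qed.

Lemma malg_lift_linear : linear malg_lift.
Proof.
move=> a u v; pose d := (msupp u `|` msupp v)%fset.
have ud : (msupp u `<=` d)%fset by apply: fsubsetUl.
have vd : (msupp v `<=` d)%fset by apply: fsubsetUr.
have uvd : (msupp (a *: u + v) `<=` d)%fset.
  apply: fsubset_trans (msuppD_le _ _) _.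
  by rewrite fsubUset vd andbT; apply: fsubset_trans (msuppZ_le _ _) ud.
rewrite (malg_liftEw ud) (malg_liftEw vd) (malg_liftEw uvd).
rewrite scaler_sumr -big_split /=; apply: eq_bigr => p _.
by rewrite mcoeffD mcoeffZ scalerDl scalerA.
Qed.

HB.instance Definition _ := GRing.isLinear.Build k _ _ _ malg_lift
  malg_lift_linear.

Lemma malg_liftB u v : malg_lift (u - v) = malg_lift u - malg_lift v.
Proof. exact: raddfB. Qed.

Lemma malg_liftU v w : malg_lift << (v, w) >> = f v w.
Proof. by rewrite (malg_liftEw msuppU_le) big_seq_fset1 mcoeffUU scale1r. Qed.

Hypothesis f_bilin : bilinear_for *:%R *:%R f.

Lemma malg_lift_span g : g \in span_pred tensor_rel -> malg_lift g = 0.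
Proof.
move=> /asboolP; elim=> [|a u v Ru _ IH]; first exact: linear0.
rewrite malg_lift_linear IH addr0.
suff -> : malg_lift u = 0 by rewrite scaler0.
case: Ru => [b x y z|b x y z]; rewrite malg_liftB malg_lift_linear !malg_liftU.
  by have /= -> := f_bilin.1 z b x y; rewrite subrr.
by have /= -> := f_bilin.2 x b y z; rewrite subrr.
Qed.

Lemma tlift_proj g : tlift (quot_proj tensor_rel g) = malg_lift g.
Proof.
apply/eqP; rewrite -subr_eq0 -malg_liftB; apply/eqP/malg_lift_span.
by apply/quot_projP; rewrite quot_projK.
Qed.

Lemma tlift_linear : linear tlift.
Proof.
move=> a x y; rewrite -[x]quot_projK -[y]quot_projK -quot_proj_is_linear !tlift_proj.
exact: malg_lift_linear.
Qed.

Lemma tliftE v w : tlift (tens v w) = f v w.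
Proof. by rewrite tlift_proj malg_liftU. Qed.

Lemma tlift0 : tlift 0 = 0.
Proof.
have := tlift_linear (-1) 0 0.
by rewrite scaler0 addr0 scaleN1r addNr.
Qed.

End Lift.

Lemma tensP (P : tensor -> Prop) :
  P 0 -> (forall a v w x, P x -> P (a *: tens v w + x)) -> forall x, P x.
Proof.
move=> P0 PD x; rewrite -[x]quot_projK; move: (repr x) => g.
rewrite [g]monalgE; elim/big_rec: _ => [|[v w] h _ IH].
  by rewrite (raddf0 (quot_proj tensor_rel)).
have -> : << g@_(v, w) *g (v, w) >> = g@_(v, w) *: << (v, w) >>.
  by apply/malgP => p; rewrite mcoeffZ !mcoeffU mulr_natr.
by rewrite quot_proj_is_linear; apply: PD.
Qed.

Lemma tlift_param (Z U : lmodType k) (g : Z -> V -> W -> U) :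
  (forall z, bilinear_for *:%R *:%R (g z)) ->
  (forall v w, linear (fun z => g z v w)) ->
  forall x, linear (fun z => tlift (g z) x).
Proof.
move=> gB gL x a y z; elim/tensP: x => [|b v w x IH].
  by rewrite !tlift0 // scaler0 addr0.
rewrite !tlift_linear // !tliftE // IH gL.
by rewrite !scalerDr !scalerA mulrC !addrA; congr (_ + _); rewrite addrAC.
Qed.

End Tensor.

(* keeps unification from unfolding down to representatives *)
Global Opaque tens tlift.

Notation "V '⊗m' W" := (tensor V W) (at level 40, left associativity)
  : type_scope.
Notation "v ⊗ w" := (tens v w) (at level 40, left associativity) : ring_scope.

(* Sweedler summation: for d = \sum_i x_i (x) y_i and E bilinear in x and y,
   this is \sum_i E[x_i, y_i]. *)
Notation "\tsum_ ( x , y <- d ) E" := (tlift (fun x y => E) d)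
  (at level 41, E at level 41, x binder, y binder, d at level 50,
   format "'[' \tsum_ ( x ,  y  <-  d ) '/  '  E ']'") : ring_scope.

Section TensorMaps.
Variable k : fieldType.
Implicit Types U V W : lmodType k.

Definition tmap U U' V V' (f : U -> U') (g : V -> V') (x : U ⊗m V) : U' ⊗m V' :=
  \tsum_(u, v <- x) f u ⊗ g v.

Definition tassoc U V W (x : (U ⊗m V) ⊗m W) : U ⊗m (V ⊗m W) :=
  \tsum_(y, w <- x) \tsum_(u, v <- y) u ⊗ (v ⊗ w).

Definition tassocV U V W (x : U ⊗m (V ⊗m W)) : (U ⊗m V) ⊗m W :=
  \tsum_(u, y <- x) \tsum_(v, w <- y) (u ⊗ v) ⊗ w.

Lemma tensZDl V W (w : W) a (v v' : V) :
  (a *: v + v') ⊗ w = a *: (v ⊗ w) + v' ⊗ w.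
Proof. exact: (tens_bilinear V W).1. Qed.

Lemma tensZDr V W (v : V) a (w w' : W) :
  v ⊗ (a *: w + w') = a *: (v ⊗ w) + v ⊗ w'.
Proof. exact: (tens_bilinear V W).2. Qed.

Lemma tmap_bilinear U U' V V' (f : {linear U -> U'}) (g : {linear V -> V'}) :
  bilinear_for *:%R *:%R (fun u v => f u ⊗ g v).
Proof. by split=> z a x y; rewrite linearP (tensZDl, tensZDr). Qed.

Lemma tmapE U U' V V' (f : {linear U -> U'}) (g : {linear V -> V'}) u v :
  tmap f g (u ⊗ v) = f u ⊗ g v.
Proof. exact: tliftE (tmap_bilinear f g) _ _. Qed.

Lemma tmap_linear U U' V V' (f : {linear U -> U'}) (g : {linear V -> V'}) :
  linear (tmap f g).
Proof. exact: tlift_linear (tmap_bilinear f g). Qed.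

Lemma tassoc_bilin1 U V W (w : W) :
  bilinear_for *:%R *:%R (fun (u : U) (v : V) => u ⊗ (v ⊗ w)).
Proof. by split=> z a x y; rewrite ?tensZDl ?tensZDr. Qed.

Lemma tassoc_bilin2 U V W :
  bilinear_for *:%R *:%R
    (fun (y : U ⊗m V) (w : W) => \tsum_(u, v <- y) u ⊗ (v ⊗ w)).
Proof.
split=> [w|z]; first exact: tlift_linear (tassoc_bilin1 _ _ w).
apply: (tlift_param (fun w => @tassoc_bilin1 U V W w) _ z) => u v a x y /=.
by rewrite !tensZDr.
Qed.

Lemma tassocE U V W (u : U) (v : V) (w : W) :
  tassoc ((u ⊗ v) ⊗ w) = u ⊗ (v ⊗ w).
Proof.
by rewrite /tassoc (tliftE (@tassoc_bilin2 U V W)) (tliftE (tassoc_bilin1 _ _ _)).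
Qed.

End TensorMaps.


Lemma lin_id (k : fieldType) (U : lmodType k) : linear (fun x : U => x).
Proof. by []. Qed.

Lemma lin_comp (k : fieldType) (U V W : lmodType k) (f : V -> W) (g : U -> V) :
  linear f -> linear g -> linear (fun x => f (g x)).
Proof. by move=> fL gL a u v; rewrite gL fL. Qed.

Lemma tens_ext (k : fieldType) (V W U : lmodType k) (f g : V ⊗m W -> U) :
  linear f -> linear g -> (forall v w, f (v ⊗ w) = g (v ⊗ w)) -> f =1 g.
Proof.
move=> fL gL E; apply: tensP => [|a v w x IH].
  have := fL (-1) 0 0; have := gL (-1) 0 0.
  by rewrite !scaler0 !addr0 !scaleN1r !addNr => -> ->.
by rewrite (fL a (v ⊗ w) x) (gL a (v ⊗ w) x) E IH.
Qed.

Section TensorMul.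
Variables (k : fieldType) (V W : lmodType k).
Variables (mV : V -> V -> V) (mW : W -> W -> W) (oneV : V) (oneW : W).
Hypotheses (mVB : bilinear_for *:%R *:%R mV) (mWB : bilinear_for *:%R *:%R mW).
Hypotheses (mVA : associative mV) (mWA : associative mW).
Hypotheses (mV1l : left_id oneV mV) (mV1r : right_id oneV mV).
Hypotheses (mW1l : left_id oneW mW) (mW1r : right_id oneW mW).
Implicit Types x y z : V ⊗m W.

Definition tens_mul x y : V ⊗m W :=
  \tsum_(v, w <- x) \tsum_(v', w' <- y) mV v v' ⊗ mW w w'.

Lemma tens_mul_bilin1 v w :
  bilinear_for *:%R *:%R (fun v' w' => mV v v' ⊗ mW w w').
Proof.
split=> z c x y /=.
  by have /= -> := mVB.2 v c x y; rewrite tensZDl.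
by have /= -> := mWB.2 w c x y; rewrite tensZDr.
Qed.

Lemma tens_mul_bilin2 y :
  bilinear_for *:%R *:%R
    (fun v w => \tsum_(v', w' <- y) mV v v' ⊗ mW w w').
Proof.
split=> z.
  apply: (tlift_param (fun v => tens_mul_bilin1 v z) _ y) => v' w' c x x'.
  by have /= -> := mVB.1 v' c x x'; rewrite tensZDl.
apply: (tlift_param (tens_mul_bilin1 z) _ y) => v' w' c x x'.
by have /= -> := mWB.1 w' c x x'; rewrite tensZDr.
Qed.

Lemma tens_mulE v w v' w' :
  tens_mul (v ⊗ w) (v' ⊗ w') = mV v v' ⊗ mW w w'.
Proof.
by rewrite /tens_mul (tliftE (tens_mul_bilin2 _)) (tliftE (tens_mul_bilin1 _ _)).
Qed.

Lemma tens_mul_linl y : linear (tens_mul^~ y).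
Proof. exact: (tlift_linear (tens_mul_bilin2 y)). Qed.

Lemma tens_mul_linr x : linear (tens_mul x).
Proof.
apply: (tlift_param tens_mul_bilin2 _ x) => v w.
exact: (tlift_linear (tens_mul_bilin1 v w)).
Qed.

Lemma tens_mulDl : left_distributive tens_mul +%R.
Proof. by move=> x y z; have := tens_mul_linl z 1 x y; rewrite !scale1r. Qed.

Lemma tens_mulDr : right_distributive tens_mul +%R.
Proof. by move=> x y z; have := tens_mul_linr x 1 y z; rewrite !scale1r. Qed.

Lemma tens_mulA : associative tens_mul.
Proof.
move=> x y z; move: x; apply: tens_ext => [||v w].
- exact: tens_mul_linl.
- by apply: lin_comp; exact: tens_mul_linl.
move: y; apply: tens_ext => [||v' w'].
- by apply: lin_comp; [exact: tens_mul_linr|exact: tens_mul_linl].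
- by apply: lin_comp; [exact: tens_mul_linl|exact: tens_mul_linr].
move: z; apply: tens_ext => [||v'' w''].
- by apply: lin_comp; exact: tens_mul_linr.
- exact: tens_mul_linr.
by rewrite !tens_mulE mVA mWA.
Qed.

Lemma tens_mul1x : left_id (oneV ⊗ oneW) tens_mul.
Proof.
apply: tens_ext => [||v w]; [exact: tens_mul_linr|exact: lin_id|].
by rewrite tens_mulE mV1l mW1l.
Qed.

Lemma tens_mulx1 : right_id (oneV ⊗ oneW) tens_mul.
Proof.
apply: tens_ext => [||v w]; [exact: tens_mul_linl|exact: lin_id|].
by rewrite tens_mulE mV1r mW1r.
Qed.

End TensorMul.

Section TensorAlgebra.
Variable k : fieldType.

Lemma alg_mul_bilinear (A : algType k) : bilinear_for *:%R *:%R (@GRing.mul A).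
Proof.
by split=> z a x y /=; rewrite (mulrDl, mulrDr) -?scalerAl -?scalerAr.
Qed.

Variables A B : algType k.
Let AB := @alg_mul_bilinear A.
Let BB := @alg_mul_bilinear B.

HB.instance Definition _ := GRing.Zmodule_isPzRing.Build (A ⊗m B)
  (tens_mulA AB BB (@mulrA A) (@mulrA B))
  (tens_mul1x AB BB (@mul1r A) (@mul1r B))
  (tens_mulx1 AB BB (@mulr1 A) (@mulr1 B))
  (tens_mulDl AB BB) (tens_mulDr AB BB).

Lemma tens1 : (1 : A ⊗m B) = 1 ⊗ 1.
Proof. by []. Qed.

Lemma tensM (a a' : A) (b b' : B) : (a ⊗ b) * (a' ⊗ b') = (a * a') ⊗ (b * b').
Proof. exact: (tens_mulE AB BB). Qed.

End TensorAlgebra.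

Section QuotientAlgebra.
Variables (k : fieldType) (F : algType k) (S : F -> Prop).

(* the linear span of ideal_gen is the two-sided ideal generated by S *)
Inductive ideal_gen : F -> Prop :=
| IdealGen a s b : S s -> ideal_gen (a * s * b).

Definition quot_alg := quot_mod ideal_gen.
HB.instance Definition _ := GRing.Lmodule.on quot_alg.

Local Notation pr := (quot_proj ideal_gen).

Lemma ideal_mull a u : u \in span_pred ideal_gen -> a * u \in span_pred ideal_gen.
Proof.
move=> /asboolP; elim=> [|c _ v [b s d Ss] _ IH]; first by rewrite mulr0 rpred0.
rewrite mulrDr -scalerAr !mulrA rpredD //; apply/spanZ/span_gen.
exact: IdealGen.
Qed.

Lemma ideal_mulr a u : u \in span_pred ideal_gen -> u * a \in span_pred ideal_gen.
Proof.
move=> /asboolP; elim=> [|c _ v [b s d Ss] _ IH]; first by rewrite mul0r rpred0.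
rewrite mulrDl -scalerAl -(mulrA (b * s)) rpredD //; apply/spanZ/span_gen.
exact: IdealGen.
Qed.

Definition quot_mul (x y : quot_alg) : quot_alg := pr (repr x * repr y).

Lemma quot_projM u v : quot_mul (pr u) (pr v) = pr (u * v).
Proof.
apply/quot_projP; rewrite -(subrK (repr (pr u) * v) (_ * _)) -mulrBr.
rewrite -addrA -mulrBl rpredD //; [apply: ideal_mull|apply: ideal_mulr];
by apply/quot_projP; rewrite quot_projK.
Qed.

Fact quot_mulA : associative quot_mul.
Proof.
by move=> x y z; rewrite -[x]quot_projK -[y]quot_projK -[z]quot_projK
  !quot_projM mulrA.
Qed.

Fact quot_mul1x : left_id (pr 1) quot_mul.
Proof. by move=> x; rewrite -[x]quot_projK quot_projM mul1r. Qed.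

Fact quot_mulx1 : right_id (pr 1) quot_mul.
Proof. by move=> x; rewrite -[x]quot_projK quot_projM mulr1. Qed.

Fact quot_mulDl : left_distributive quot_mul +%R.
Proof.
move=> x y z; rewrite -[x]quot_projK -[y]quot_projK -[z]quot_projK.
by rewrite -quot_projD !quot_projM mulrDl quot_projD.
Qed.

Fact quot_mulDr : right_distributive quot_mul +%R.
Proof.
move=> x y z; rewrite -[x]quot_projK -[y]quot_projK -[z]quot_projK.
by rewrite -quot_projD !quot_projM mulrDr quot_projD.
Qed.

HB.instance Definition _ := GRing.Zmodule_isPzRing.Build quot_alg
  quot_mulA quot_mul1x quot_mulx1 quot_mulDl quot_mulDr.

Definition alg_proj (u : F) : quot_alg := pr u.

Lemma alg_projK (x : quot_alg) : alg_proj (repr x) = x.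
Proof. exact: quot_projK. Qed.

Lemma alg_projD u v : alg_proj (u + v) = alg_proj u + alg_proj v.
Proof. exact: quot_projD. Qed.

Lemma alg_projZ a u : alg_proj (a *: u) = a *: alg_proj u.
Proof. exact: quot_projZ. Qed.

Lemma alg_projM u v : alg_proj (u * v) = alg_proj u * alg_proj v.
Proof. by symmetry; exact: quot_projM. Qed.

Lemma alg_proj_rel s : S s -> alg_proj s = 0.
Proof.
move=> Ss; rewrite -[RHS](raddf0 pr); apply/quot_projP; rewrite subr0.
by apply: span_gen; rewrite -[s]mul1r -[X in ideal_gen X]mulr1; exact: IdealGen.
Qed.

Fact quot_scaleAl a (x y : quot_alg) : a *: (x * y) = a *: x * y.
Proof.
rewrite -[x]alg_projK -[y]alg_projK.
by rewrite -alg_projZ -!alg_projM -alg_projZ scalerAl.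
Qed.

Fact quot_scaleAr a (x y : quot_alg) : a *: (x * y) = x * (a *: y).
Proof.
rewrite -[x]alg_projK -[y]alg_projK.
by rewrite -alg_projZ -!alg_projM -alg_projZ scalerAr.
Qed.

End QuotientAlgebra.

Section FreeAlgebra.
Variables (k : fieldType) (I : choiceType).

Definition free_alg := {malg k[{fmonom I}]}.
HB.instance Definition _ := GRing.Lalgebra.on free_alg.

Definition free_gen (i : I) : free_alg := << fmu i >>.

Fact malg_scaleAr (K : monomType) (a : k) (x y : {malg k[K]}) :
  a *: (x * y) = x * (a *: y).
Proof.
apply/malgP => m; rewrite mcoeffZ mcoeffMl.
rewrite (mcoeffMlw m (fsubset_refl _) (msuppZ_le a y)) mulr_sumr.
apply: eq_bigr => m1 _; rewrite mulr_sumr; apply: eq_bigr => m2 _.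
by rewrite mcoeffZ mulrnAr mulrCA.
Qed.

HB.instance Definition _ := GRing.Lalgebra_isAlgebra.Build k free_alg
  (@malg_scaleAr {fmonom I}).

End FreeAlgebra.

Section Kernels.
Variables (k : fieldType) (T : finType).
Implicit Types X Y : T -> T -> k.

(* matrices with rows and columns indexed by T *)
Definition kmul X Y : T -> T -> k := fun x y => \sum_z X x z * Y z y.
Definition kid : T -> T -> k := fun x y => (x == y)%:R.

End Kernels.

Section RMatrix.
Variables (k : fieldType) (n : nat).

(* elements of M_n (x) M_n by entries: R i j k l stands for R^i_j^k_l *)
Definition tensor_mx := 'I_n -> 'I_n -> 'I_n -> 'I_n -> k.
Implicit Types R : tensor_mx.

Definition op2 R (x y : 'I_n * 'I_n) : k := R x.1 y.1 x.2 y.2.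

Definition R12 R (x y : 'I_n * 'I_n * 'I_n) : k :=
  R x.1.1 y.1.1 x.1.2 y.1.2 * (x.2 == y.2)%:R.
Definition R13 R (x y : 'I_n * 'I_n * 'I_n) : k :=
  R x.1.1 y.1.1 x.2 y.2 * (x.1.2 == y.1.2)%:R.
Definition R23 R (x y : 'I_n * 'I_n * 'I_n) : k :=
  R x.1.2 y.1.2 x.2 y.2 * (x.1.1 == y.1.1)%:R.

Definition yang_baxter R : Prop :=
  kmul (kmul (R12 R) (R13 R)) (R23 R) =2 kmul (kmul (R23 R) (R13 R)) (R12 R).

Definition tensor_mx_invertible R : Prop :=
  exists R' : tensor_mx, kmul (op2 R) (op2 R') =2 @kid k _ /\
                         kmul (op2 R') (op2 R) =2 @kid k _.

End RMatrix.

Section BraidedAlgebra.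
Variables (k : fieldType) (A : lmodType k).
Variables (mu : {linear A ⊗m A -> A}) (Psi : {linear A ⊗m A -> A ⊗m A}).

Definition Psi12 (x : A ⊗m A ⊗m A) : A ⊗m A ⊗m A := tmap Psi idfun x.
Definition Psi23 (x : A ⊗m A ⊗m A) : A ⊗m A ⊗m A :=
  tassocV (tmap idfun Psi (tassoc x)).

Record braided_algebra : Prop := {
  braided_mulA : forall a b c, mu (mu (a ⊗ b) ⊗ c) = mu (a ⊗ mu (b ⊗ c));
  braided_braid : forall x, Psi12 (Psi23 (Psi12 x)) = Psi23 (Psi12 (Psi23 x));
  braided_mull : forall a b c,
    Psi (mu (a ⊗ b) ⊗ c) =
    tmap idfun mu (tassoc (Psi12 (Psi23 (a ⊗ b ⊗ c))));
  braided_mulr : forall a b c,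
    Psi (a ⊗ mu (b ⊗ c)) = tmap mu idfun (Psi23 (Psi12 (a ⊗ b ⊗ c)))
}.

End BraidedAlgebra.

Section Bialgebra.
Variables (k : fieldType) (H : algType k).
Variables (Delta : H -> H ⊗m H) (eps : H -> k).

Record bialgebra : Prop := {
  Delta_linear : linear Delta;
  eps_linear : scalar eps;
  coassoc : forall a, tassoc (tmap Delta idfun (Delta a)) =
                      tmap idfun Delta (Delta a);
  counitl : forall a, \tsum_(a1, a2 <- Delta a) (eps a1 *: a2) = a;
  counitr : forall a, \tsum_(a1, a2 <- Delta a) (eps a2 *: a1) = a;
  Delta1 : Delta 1 = 1;
  DeltaM : forall a b, Delta (a * b) = Delta a * Delta b;
  eps1 : eps 1 = 1;
  epsM : forall a b, eps (a * b) = eps a * eps b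
}.

(* r * r' in the convolution algebra of linear forms on H (x) H *)
Definition conv (r r' : H ⊗m H -> k) (a b : H) : k :=
  \tsum_(a1, a2 <- Delta a)
    (\tsum_(b1, b2 <- Delta b) (r (a1 ⊗ b1) * r' (a2 ⊗ b2) : k^o)).

Definition conv_invertible (r : H ⊗m H -> k) : Prop :=
  exists2 r' : H ⊗m H -> k, scalar r' &
    forall a b, conv r r' a b = eps a * eps b /\
                conv r' r a b = eps a * eps b.

Record dual_quasitriangular_form (r : H ⊗m H -> k) : Prop := {
  dqt_linear : scalar r;
  (* Convolution-invertibility is part of the notion: without it r = 0 would
     satisfy the three identities below on every bialgebra. *)
  dqt_invertible : conv_invertible r;
  dqt_mull : forall a b c, r ((a * b) ⊗ c) =
    \tsum_(c1, c2 <- Delta c) (r (a ⊗ c1) * r (b ⊗ c2) : k^o);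
  dqt_mulr : forall a b c, r (a ⊗ (b * c)) =
    \tsum_(a1, a2 <- Delta a) (r (a1 ⊗ c) * r (a2 ⊗ b) : k^o);
  dqt_comm : forall a b,
    \tsum_(a1, a2 <- Delta a)
      (\tsum_(b1, b2 <- Delta b) (r (a2 ⊗ b2) *: (b1 * a1))) =
    \tsum_(a1, a2 <- Delta a)
      (\tsum_(b1, b2 <- Delta b) (r (a1 ⊗ b1) *: (a2 * b2)))
}.

Definition dual_quasitriangular : Prop := exists r, dual_quasitriangular_form r.

End Bialgebra.

Section M1.
Variables (k : fieldType) (n : nat).
Variables (R : tensor_mx k n) (c : 'I_n -> 'I_n -> 'I_n -> k).

Local Notation F := (free_alg k ('I_n * 'I_n)%type).
Local Notation T i j := (free_gen k (i, j) : F).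

(* c i j a stands for c_ij^a *)
Inductive M1_rel : F -> Prop :=
| M1_rel_RTT i j p l :
    M1_rel (\sum_a \sum_b R i a j b *: (T a p * T b l)
            - \sum_a \sum_b R a p b l *: (T j b * T i a))
| M1_rel_alg i j p :
    M1_rel (\sum_a c i j a *: T p a
            - \sum_a \sum_b c a b p *: (T a i * T b j)).

Definition M1 := quot_alg M1_rel.
HB.instance Definition _ := GRing.PzRing.on M1.
HB.instance Definition _ := GRing.Lmodule.on M1.

Definition M1_gen (i j : 'I_n) : M1 := alg_proj M1_rel (T i j).

(* t^i_j |-> delta^i_j respects the relations, whence 1 <> 0 in M1 *)
Definition delta_word (w : {fmonom ('I_n * 'I_n)%type}) : k :=
  \prod_(ij <- w : seq _) (ij.1 == ij.2)%:R.

Fact delta_word_mmorphism : mmorphism delta_word.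
Proof.
by split=> [w w'|]; rewrite /delta_word ?fmM ?big_cat // fm1 big_nil.
Qed.

HB.instance Definition _ := isMultiplicative.Build _ k delta_word
  delta_word_mmorphism.

Definition delta_free : F -> k := mmap idfun delta_word.

Fact delta_freeM u v : delta_free (u * v) = delta_free u * delta_free v.
Proof. exact: rmorphM. Qed.

Fact delta_free1 : delta_free 1 = 1.
Proof. exact: rmorph1. Qed.

Fact delta_freeZ a u : delta_free (a *: u) = a * delta_free u.
Proof. exact: linearZ. Qed.

Fact delta_freeD u v : delta_free (u + v) = delta_free u + delta_free v.
Proof. exact: raddfD. Qed.

Fact delta_freeB u v : delta_free (u - v) = delta_free u - delta_free v.
Proof. exact: raddfB. Qed.

Fact delta_free_sum (G : 'I_n -> F) :
  delta_free (\sum_i G i) = \sum_i delta_free (G i).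
Proof. exact: raddf_sum. Qed.

Fact delta_freeT i j : delta_free (T i j) = (i == j)%:R.
Proof. by rewrite /delta_free mmapU /= mul1r /delta_word fmU big_seq1. Qed.

Fact sum_deltar (G : 'I_n -> k) i : \sum_a G a * (a == i)%:R = G i.
Proof.
rewrite (bigD1 i) //= eqxx mulr1 big1 ?addr0 // => a /negPf ->.
by rewrite mulr0.
Qed.

Fact sum_deltal (G : 'I_n -> k) i : \sum_a G a * (i == a)%:R = G i.
Proof.
by rewrite -[RHS]sum_deltar; apply: eq_bigr => a _; rewrite eq_sym.
Qed.

Fact sum_deltarr (G : 'I_n -> 'I_n -> k) i j :
  \sum_a \sum_b G a b * ((a == i)%:R * (b == j)%:R) = G i j.
Proof.
rewrite -[RHS](sum_deltar (G^~ j)); apply: eq_bigr => a _.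
rewrite -[G a j](sum_deltar (G a)) mulr_suml; apply: eq_bigr => b _.
by rewrite -mulrA [X in _ * X]mulrC.
Qed.

Fact delta_free_sum2 (G : 'I_n -> 'I_n -> k) (U V : 'I_n -> 'I_n -> F) :
  delta_free (\sum_a \sum_b G a b *: (U a b * V a b)) =
  \sum_a \sum_b G a b * (delta_free (U a b) * delta_free (V a b)).
Proof.
rewrite delta_free_sum; apply: eq_bigr => a _; rewrite delta_free_sum.
by apply: eq_bigr => b _; rewrite delta_freeZ delta_freeM.
Qed.

Fact delta_free_rel u : M1_rel u -> delta_free u = 0.
Proof.
case=> [i j p l|i j p]; rewrite delta_freeB; apply/eqP; rewrite subr_eq0;
  apply/eqP.
  apply: (etrans (delta_free_sum2 (fun a b => R i a j b) (fun a _ => T a p)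
                    (fun _ b => T b l))).
  apply/esym; apply: (etrans (delta_free_sum2 (fun a b => R a p b l)
                    (fun _ b => T j b) (fun a _ => T i a))).
  transitivity (R i p j l).
    rewrite -[RHS](sum_deltarr (fun a b => R a p b l)).
    apply: eq_bigr => a _; apply: eq_bigr => b _; rewrite !delta_freeT.
    by rewrite (eq_sym j) (eq_sym i) [X in _ = _ * X]mulrC.
  rewrite -[LHS](sum_deltarr (fun a b => R i a j b)).
  by apply: eq_bigr => a _; apply: eq_bigr => b _; rewrite !delta_freeT.
apply/esym; apply: (etrans (delta_free_sum2 (fun a b => c a b p)
                  (fun a _ => T a i) (fun _ b => T b j))).
transitivity (c i j p).
  rewrite -[RHS](sum_deltarr (fun a b => c a b p)).
  by apply: eq_bigr => a _; apply: eq_bigr => b _; rewrite !delta_freeT.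
rewrite delta_free_sum -[LHS](sum_deltal (c i j)).
by apply: eq_bigr => a _; rewrite delta_freeZ delta_freeT.
Qed.

Fact delta_free_ideal u : u \in span_pred (ideal_gen M1_rel) -> delta_free u = 0.
Proof.
move=> /asboolP; elim=> [|a _ v [x s y Rs] _ IH].
  by rewrite -(subrr 0) delta_freeB subrr.
rewrite delta_freeD IH addr0 delta_freeZ !delta_freeM (delta_free_rel Rs).
by rewrite mulr0 mul0r mulr0.
Qed.

Fact M1_oner_neq0 : (1 : M1) != 0.
Proof.
apply/eqP; rewrite -(raddf0 (quot_proj (ideal_gen M1_rel))) => /quot_projP.
by rewrite subr0 => /delta_free_ideal /eqP; rewrite delta_free1 oner_eq0.
Qed.

HB.instance Definition _ := GRing.PzSemiRing_isNonZero.Build M1 M1_oner_neq0.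
HB.instance Definition _ := GRing.Lmodule_isLalgebra.Build k M1
  (@quot_scaleAl k F M1_rel).
HB.instance Definition _ := GRing.Lalgebra_isAlgebra.Build k M1
  (@quot_scaleAr k F M1_rel).

End M1.

(* Main.v *)
Require Import Defs.
From HB Require Import structures.
From mathcomp Require Import all_boot all_order all_algebra.
From mathcomp Require Import generic_quotient sesquilinear.
From mathcomp Require Import boolp finmap monalg.

Set Implicit Arguments.
Unset Strict Implicit.
Unset Printing Implicit Defensive.

(* Every element of M = M_1(R, A) is a combination of entries of products of the
   generating matrix t, and these products T are multiplicative matrices:
   Delta T_xy = sum_z T_xz (x) T_zy. On their entries all Sweedler sums become
   finite sums of products of matrices.

   Suppose Q satisfies the mixed Yang-Baxter equations with R and is compatible
   with the structure constants c. By the universal property of M,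
   t^i_j |-> (Q^m_q^i_j)_mq extends to an antimultiplicative map from M to the
   n x n matrices; its entries, seen as linear forms on M, respect the relations
   of M in the convolution algebra M^*, so that they define a multiplicative map
   M -> M^*, i.e. a form r_Q on M (x) M with r_Q(t^i_j, t^k_l) = Q^i_j^k_l.

   The matrix Q = R gives the dual quasitriangular structure. Both R and
   R_21^{-1} are admissible, and r_{R_21^{-1}} composed with the flip is the
   convolution inverse of r_R. The quasicommutativity and the inversion
   identities pass from T, T' to their product T T' in either argument, so they
   need only be checked on t, where they are the RTT relations and
   R R^{-1} = 1. *)

Import GRing.Theory.

Local Open Scope ring_scope.

(** * Linear maps and the universal property of M1 *)

Lemma lin0 (k : fieldType) (U V : lmodType k) (f : U -> V) :
  linear f -> f 0 = 0.
Proof. by move=> /(_ (-1) 0 0); rewrite scaler0 addr0 scaleN1r addNr. Qed.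

Section LinearSums.
Variables (k : fieldType) (U V : lmodType k) (f : U -> V).
Hypothesis fL : linear f.

Lemma linB u v : f (u - v) = f u - f v.
Proof. by rewrite addrC -scaleN1r fL scaleN1r addrC. Qed.

Lemma linZ a u : f (a *: u) = a *: f u.
Proof. by rewrite -[a *: u]addr0 fL (lin0 fL) addr0. Qed.

Lemma lin_sum (I : finType) (g : I -> U) : f (\sum_i g i) = \sum_i f (g i).
Proof.
elim/big_rec2: _ => [|i y x _ <-]; first exact: lin0.
by rewrite -[g i]scale1r fL !scale1r.
Qed.

Lemma lin_sumZ (I : finType) (a : I -> k) (u : I -> U) :
  f (\sum_i a i *: u i) = \sum_i a i *: f (u i).
Proof. by rewrite lin_sum; apply: eq_bigr => i _; rewrite linZ. Qed.

Lemma lin_sumZ2 (I J : finType) (a : I -> J -> k) (u : I -> J -> U) :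
  f (\sum_i \sum_j a i j *: u i j) = \sum_i \sum_j a i j *: f (u i j).
Proof. by rewrite lin_sum; apply: eq_bigr => i _; rewrite lin_sumZ. Qed.

End LinearSums.

Section ScalarSums.
Variables (k : fieldType) (U : lmodType k) (f : U -> k).
Hypothesis fL : scalar f.

Lemma scalar_sumZ (I : finType) (a : I -> k) (u : I -> U) :
  f (\sum_i a i *: u i) = \sum_i a i * f (u i).
Proof. exact: (lin_sumZ (V := k^o)). Qed.

Lemma scalar_sumZ2 (I J : finType) (a : I -> J -> k) (u : I -> J -> U) :
  f (\sum_i \sum_j a i j *: u i j) = \sum_i \sum_j a i j * f (u i j).
Proof. exact: (lin_sumZ2 (V := k^o)). Qed.

End ScalarSums.

(** * The universal property of the free algebra *)

Section FreeAlgebraLift.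
Variables (k : fieldType) (I : choiceType).
Local Notation F := (free_alg k I).

Lemma free_alg_ind (P : F -> Prop) :
  P 0 -> (forall a (w : {fmonom I}) u, P u -> P (a *: (<< w >> : F) + u)) ->
  forall u, P u.
Proof.
move=> P0 PD u; rewrite [u]monalgE; elim/big_rec: _ => [//|w h _ IH].
have -> : << u@_w *g w >> = u@_w *: (<< w >> : {malg k[{fmonom I}]}).
  by apply/malgP => p; rewrite mcoeffZ !mcoeffU mulr_natr.
exact: PD.
Qed.

Lemma free_alg_ext (V : lmodType k) (f g : F -> V) :
  linear f -> linear g ->
  (forall w : {fmonom I}, f << w >> = g << w >>) -> f =1 g.
Proof.
move=> fL gL E; apply: free_alg_ind => [|a w u IH].
  by rewrite !lin0.
by rewrite fL gL E IH.
Qed.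

Lemma free_alg_monoM (w w' : {fmonom I}) :
  (<< mmul w w' >> : F) = << w >> * << w' >>.
Proof. by rewrite [RHS]malgM_def fgmulUU mulr1. Qed.

Variables (B : lmodType k) (op : B -> B -> B) (one : B).
Hypotheses (opB : bilinear_for *:%R *:%R op) (opA : associative op).
Hypotheses (op1l : left_id one op) (op1r : right_id one op).
Variable f : I -> B.

Definition word_lift (w : seq I) : B := foldr (fun i => op (f i)) one w.

Lemma word_lift_cat w w' :
  word_lift (w ++ w') = op (word_lift w) (word_lift w').
Proof. by elim: w => [|i w IH] /=; rewrite ?op1l // IH opA. Qed.

(** The target is a module with a bare associative operation, so that it may be the matrices under
    the reversed product or the linear forms under convolution. *)
Definition free_lift (u : F) : B :=
  \sum_(w <- msupp u) u@_w *: word_lift w.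

Lemma free_liftEw (d : {fset {fmonom I}}%fset) (u : F) :
  (msupp u `<=` d)%fset ->
  free_lift u = \sum_(w <- d) u@_w *: word_lift w.
Proof.
move=> le; rewrite [LHS](big_fset_incl _ le) => //= x xd /mcoeff_outdom ->.
by rewrite scale0r.
Qed.

Lemma free_lift_is_linear : linear free_lift.
Proof.
move=> a u v; pose d := (msupp u `|` msupp v)%fset.
have ud : (msupp u `<=` d)%fset by apply: fsubsetUl.
have vd : (msupp v `<=` d)%fset by apply: fsubsetUr.
have uvd : (msupp (a *: u + v) `<=` d)%fset.
  apply: fsubset_trans (msuppD_le _ _) _.
  by rewrite fsubUset vd andbT; apply: fsubset_trans (msuppZ_le _ _) ud.
rewrite (free_liftEw ud) (free_liftEw vd) (free_liftEw uvd).
rewrite scaler_sumr -big_split /=; apply: eq_bigr => w _.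
by rewrite mcoeffD mcoeffZ scalerDl scalerA.
Qed.

HB.instance Definition _ := GRing.isLinear.Build k F B _ free_lift
  free_lift_is_linear.

Lemma free_lift_mono (w : {fmonom I}) : free_lift << w >> = word_lift w.
Proof.
by rewrite (free_liftEw msuppU_le) big_seq_fset1 mcoeffUU scale1r.
Qed.

Lemma free_lift1 : free_lift 1 = one.
Proof. by rewrite [LHS]free_lift_mono fm1. Qed.

Lemma free_lift_gen i : free_lift (free_gen k i) = f i.
Proof. by rewrite free_lift_mono fmU /= op1r. Qed.

Lemma free_liftM u v : free_lift (u * v) = op (free_lift u) (free_lift v).
Proof.
have fL := free_lift_is_linear; have mB := alg_mul_bilinear F.
move: u; apply: free_alg_ext => [||w].
- exact: lin_comp fL (mB.1 v).
- exact: lin_comp (opB.1 _) fL.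
move: v; apply: free_alg_ext => [||w'].
- exact: lin_comp fL (mB.2 _).
- exact: lin_comp (opB.2 _) fL.
by rewrite -free_alg_monoM !free_lift_mono fmM word_lift_cat.
Qed.

End FreeAlgebraLift.

Section WordMatrices.
Variables (n : nat) (H : pzRingType) (t : 'I_n -> 'I_n -> H).

(** Multi-indices of length N. Nested pairs let an induction on N split off the first letter of a
    word and treat the rest as an entry of a shorter matrix product. *)
Fixpoint widx (N : nat) : finType :=
  if N is N'.+1 then ('I_n * widx N')%type else unit.

Fixpoint wmx (N : nat) : widx N -> widx N -> H :=
  match N with
  | 0 => fun _ _ => 1
  | N'.+1 => fun x y => t x.1 y.1 * wmx x.2 y.2
  end.

End WordMatrices.

Section M1Lift.
Variables (k : fieldType) (n : nat) (R : tensor_mx k n).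
Variable (c : 'I_n -> 'I_n -> 'I_n -> k).
Local Notation M := (M1 R c).
Local Notation F := (free_alg k ('I_n * 'I_n)%type).
Local Notation pr := (@alg_proj k F (M1_rel R c)).
Local Notation t := (M1_gen R c).

(* alg_proj with values in M1; made opaque below because unification would
   otherwise unfold the quotient. *)
Definition M1_proj (u : F) : M := pr u.

Lemma M1_proj_linear : linear M1_proj.
Proof. by move=> a u v; rewrite /M1_proj alg_projD alg_projZ. Qed.

Lemma M1_projM u v : M1_proj (u * v) = M1_proj u * M1_proj v.
Proof. exact: alg_projM. Qed.

Lemma M1_proj_gen i j : M1_proj (free_gen k (i, j)) = t i j.
Proof. by []. Qed.

Lemma M1_proj_rel u : M1_rel R c u -> M1_proj u = 0.
Proof. exact: alg_proj_rel. Qed.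

Lemma M1_proj1 : M1_proj 1 = 1.
Proof. by []. Qed.

Opaque M1_proj.

Lemma M1_RTT i j p l :
  \sum_a \sum_b R i a j b *: (t a p * t b l) =
  \sum_a \sum_b R a p b l *: (t j b * t i a).
Proof.
have := M1_proj_rel (M1_rel_RTT R c i j p l).
rewrite (linB M1_proj_linear) => /eqP; rewrite subr_eq0 => /eqP E.
have := lin_sumZ2 M1_proj_linear (R i ^~ j)
  (fun a b => free_gen k (a, p) * free_gen k (b, l)).
rewrite {}E (lin_sumZ2 M1_proj_linear (fun a b => R a p b l)) => /esym E.
apply: (etrans _ (etrans E _)); apply: eq_bigr => a _; apply: eq_bigr => b _;
  by rewrite M1_projM !M1_proj_gen.
Qed.

Lemma M1_alg i j p :
  \sum_a c i j a *: t p a = \sum_a \sum_b c a b p *: (t a i * t b j).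
Proof.
have := M1_proj_rel (M1_rel_alg R c i j p).
rewrite (linB M1_proj_linear) => /eqP; rewrite subr_eq0 => /eqP E.
have := lin_sumZ M1_proj_linear (c i j) (fun a => free_gen k (p, a)).
rewrite {}E (lin_sumZ2 M1_proj_linear (fun a b => c a b p)) => /esym E.
apply: (etrans _ (etrans E _)); apply: eq_bigr => a _.
  by rewrite M1_proj_gen.
by apply: eq_bigr => b _; rewrite M1_projM !M1_proj_gen.
Qed.

Section Lift.
Variables (B : lmodType k) (op : B -> B -> B) (one : B).
Hypotheses (opB : bilinear_for *:%R *:%R op) (opA : associative op).
Hypotheses (op1l : left_id one op) (op1r : right_id one op).
Variable L : 'I_n -> 'I_n -> B.
Hypothesis L_RTT : forall i j p l,
  \sum_a \sum_b R i a j b *: op (L a p) (L b l) =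
  \sum_a \sum_b R a p b l *: op (L j b) (L i a).
Hypothesis L_alg : forall i j p,
  \sum_a c i j a *: L p a = \sum_a \sum_b c a b p *: op (L a i) (L b j).

(** The lift to the free algebra kills the defining relations, hence the two-sided ideal they
    generate, so its value on a representative depends only on the class. *)
Lemma M1_lift : exists phi : M -> B,
  [/\ linear phi, phi 1 = one, forall a b, phi (a * b) = op (phi a) (phi b)
    & forall i j, phi (t i j) = L i j].
Proof.
pose f := free_lift op one (fun ij : 'I_n * 'I_n => L ij.1 ij.2).
have fM u v : f (u * v) = op (f u) (f v) by exact: free_liftM.
have fL : linear f by exact: free_lift_is_linear.
have fT i j : f (free_gen k (i, j)) = L i j by exact: free_lift_gen.
have op0l x : op 0 x = 0 := lin0 (opB.1 x).
have op0r x : op x 0 = 0 := lin0 (opB.2 x).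
have f_rel s : M1_rel R c s -> f s = 0.
  case=> [i j p l|i j p]; rewrite (linB fL); apply/eqP;
    rewrite subr_eq0; apply/eqP.
    apply: etrans (lin_sumZ2 fL (fun a b => R i a j b)
      (fun a b => free_gen k (a, p) * free_gen k (b, l))) _.
    apply: etrans (esym (lin_sumZ2 fL (fun a b => R a p b l)
      (fun a b => free_gen k (j, b) * free_gen k (i, a)))).
    apply: etrans (etrans (L_RTT i j p l) _);
      by apply: eq_bigr => a _; apply: eq_bigr => b _; rewrite fM !fT.
  apply: etrans (lin_sumZ fL (c i j) (fun a => free_gen k (p, a))) _.
  apply: etrans (esym (lin_sumZ2 fL (fun a b => c a b p)
    (fun a b => free_gen k (a, i) * free_gen k (b, j)))).
  apply: etrans (etrans (L_alg i j p) _); apply: eq_bigr => a _.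
    by rewrite fT.
  by apply: eq_bigr => b _; rewrite fM !fT.
have f_ideal u : u \in span_pred (ideal_gen (M1_rel R c)) -> f u = 0.
  move=> /asboolP; elim=> [|a _ v [x s y Rs] _ IH]; first exact: lin0.
  by rewrite fL IH addr0 !fM (f_rel _ Rs) op0r op0l scaler0.
have f_pr u : f (repr (pr u)) = f u.
  apply/eqP; rewrite -subr_eq0 -(linB fL); apply/eqP/f_ideal/quot_projP.
  by rewrite quot_projK.
exists (fun x : M => f (repr x)); split.
- move=> a x y; rewrite -[x]alg_projK -[y]alg_projK -alg_projZ -alg_projD.
  by rewrite !f_pr fL.
- by rewrite (f_pr 1); exact: free_lift1.
- by move=> x y; rewrite -[x]alg_projK -[y]alg_projK -alg_projM !f_pr fM.
- by move=> i j; rewrite f_pr fT.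
Qed.
End Lift.

(** The entries of the matrices [wmx t] are the images of the monomials, and these span M1. *)
Lemma M1_ext (U : lmodType k) (f g : M -> U) : linear f -> linear g ->
  (forall N (x y : widx n N), f (wmx t x y) = g (wmx t x y)) -> f =1 g.
Proof.
move=> fL gL E x; rewrite -[x]alg_projK.
have f0 := lin0 fL.
have g0 := lin0 gL.
elim/free_alg_ind: (repr x) => [|a w u IH].
  by rewrite -[alg_proj _ _]/(M1_proj 0) (lin0 M1_proj_linear) f0 g0.
rewrite -[alg_proj _ _]/(M1_proj _) M1_proj_linear fL gL IH; congr (_ *: _ + _).
(* The multi-indices y and z collect the row and the column indices of the letters of w. *)
suff [y [z ->]] : exists (y z : widx n (size w)), M1_proj << w >> = wmx t y z.
  exact: E.
rewrite -[w]fmK /=; elim: (w : seq _) => [|[i j] s [y [z IHs]]] /=.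
  exists tt, tt; rewrite -M1_proj1; congr (M1_proj << _ >>).
  by apply/eqP; rewrite fmP fm1.
exists (i, y), (j, z); rewrite /= -IHs -M1_proj_gen -M1_projM -free_alg_monoM.
by congr (M1_proj << _ >>); apply/eqP; rewrite fmP fmM fmU.
Qed.

End M1Lift.

(** * Finite sums and matrices indexed by finite types *)

Lemma sum_unit (V : nmodType) (f : unit -> V) : \sum_x f x = f tt.
Proof. by rewrite (bigD1 tt) //= big1 ?addr0 // => -[]. Qed.

Lemma sum_pair (V : nmodType) (I J : finType) (f : I * J -> V) :
  \sum_z f z = \sum_i \sum_j f (i, j).
Proof. by rewrite pair_bigA; apply: eq_bigr => -[]. Qed.

Section Kernels.
Variable k : fieldType.

(** Rectangular form of [kmul]: the structure constants become matrices whose rows carry one tensor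
    factor fewer than their columns. *)
Definition mulk (X Y Z : finType) (f : X -> Y -> k) (g : Y -> Z -> k) :
  X -> Z -> k := fun x z => \sum_y f x y * g y z.

Lemma mulkA (X Y Z W : finType) (f : X -> Y -> k) (g : Y -> Z -> k)
  (h : Z -> W -> k) : mulk f (mulk g h) =2 mulk (mulk f g) h.
Proof.
move=> x w; rewrite /mulk.
under eq_bigr do rewrite mulr_sumr.
rewrite exchange_big /=; apply: eq_bigr => z _.
by rewrite mulr_suml; apply: eq_bigr => y _; rewrite mulrA.
Qed.

Lemma eq_mulk (X Y Z : finType) (f f' : X -> Y -> k) (g g' : Y -> Z -> k) :
  f =2 f' -> g =2 g' -> mulk f g =2 mulk f' g'.
Proof. by move=> ff gg x z; apply: eq_bigr => y _; rewrite ff gg. Qed.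

Lemma sum_kid (I : finType) (f : I -> k) i : \sum_j (i == j)%:R * f j = f i.
Proof.
rewrite (bigD1 i) //= eqxx mul1r big1 ?addr0 // => j /negPf.
by rewrite eq_sym => ->; rewrite mul0r.
Qed.

Lemma sum_kidr (I : finType) (f : I -> k) i : \sum_j f j * (j == i)%:R = f i.
Proof.
by rewrite -[RHS]sum_kid; apply: eq_bigr => j _; rewrite mulrC eq_sym.
Qed.

Lemma mulk1l (X Y : finType) (f : X -> Y -> k) : mulk (@kid k X) f =2 f.
Proof. by move=> x y; rewrite /mulk sum_kid. Qed.

Lemma mulk1r (X Y : finType) (f : X -> Y -> k) : mulk f (@kid k Y) =2 f.
Proof. by move=> x y; rewrite /mulk sum_kidr. Qed.

Lemma kid_pair (I J : finType) (x y : I * J) :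
  (x == y)%:R = (x.1 == y.1)%:R * (x.2 == y.2)%:R :> k.
Proof. by rewrite -natrM mulnb -pair_eqE. Qed.

(* Both sides sum the same product over all four indices. *)
Lemma sum_shuffle (W W' E G : finType) (a : E -> W' -> k) (b : E -> W -> k)
  (a' : G -> W' -> k) (b' : G -> W -> k) :
  \sum_(w : W * W') (\sum_e a e w.2 * b e w.1) * (\sum_g a' g w.2 * b' g w.1) =
  \sum_(e : E * G) (\sum_w' a e.1 w' * a' e.2 w') * (\sum_w b e.1 w * b' e.2 w).
Proof.
under eq_bigr do rewrite big_distrlr pair_bigA /=.
rewrite exchange_big /=; apply: eq_bigr => e _.
rewrite big_distrlr exchange_big pair_bigA /=; apply: eq_bigr => w _.
by rewrite mulrACA.
Qed.

(** Cancellation of nested crossings: summing the inner factors [f2], [g2] first gives [d] times the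
    identity in p and q, and the outer factors [f1], [g1] then contract along p = q. *)
Lemma sum_sandwich (P W W' Z : finType) (f1 g1 : P -> W' -> k)
  (f2 g2 : P -> W -> Z -> k) (d : k) :
  (forall p q, \sum_w \sum_z f2 p w z * g2 q w z = (p == q)%:R * d) ->
  \sum_w \sum_w' \sum_z
    (\sum_p f1 p w' * f2 p w z) * (\sum_q g2 q w z * g1 q w') =
  d * \sum_p \sum_w' f1 p w' * g1 p w'.
Proof.
rewrite pair_bigA; move=> E; under eq_bigr => w _.
  under eq_bigr => z _ do rewrite big_distrlr /=.
  rewrite exchange_big; under eq_bigr => p _ do rewrite exchange_big /=.
over.
rewrite exchange_big /= mulr_sumr; apply: eq_bigr => p _.
rewrite exchange_big /= mulr_sumr.
transitivity (\sum_q \sum_w' (f1 p w' * g1 q w') * ((p == q)%:R * d)).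
  apply: eq_bigr => q _.
  rewrite -(pair_bigA _ (fun w w' =>
    \sum_z f1 p w' * f2 p w z * (g2 q w z * g1 q w'))).
  rewrite exchange_big /=; apply: eq_bigr => w' _.
  rewrite -E mulr_sumr; apply: eq_bigr => w _; rewrite mulr_sumr.
  by apply: eq_bigr => z _; rewrite [g2 _ _ _ * _]mulrC mulrACA.
rewrite exchange_big /=; apply: eq_bigr => w' _.
under eq_bigr => q _ do rewrite mulrCA.
by rewrite sum_kid mulrC.
Qed.

End Kernels.

(** * Sweedler sums on multiplicative matrices *)

Section TensorSums.
Variables (k : fieldType) (V W : lmodType k).

Lemma tens_suml (I : finType) (v : I -> V) (w : W) :
  (\sum_i v i) ⊗ w = \sum_i v i ⊗ w.
Proof. exact: (lin_sum ((tens_bilinear V W).1 w)). Qed.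

Lemma tens_sumr (I : finType) (v : V) (w : I -> W) :
  v ⊗ (\sum_i w i) = \sum_i v ⊗ w i.
Proof. exact: (lin_sum ((tens_bilinear V W).2 v)). Qed.

Lemma tensZl a (v : V) (w : W) : (a *: v) ⊗ w = a *: (v ⊗ w).
Proof. exact: (linZ ((tens_bilinear V W).1 w)). Qed.

Lemma tensZr a (v : V) (w : W) : v ⊗ (a *: w) = a *: (v ⊗ w).
Proof. exact: (linZ ((tens_bilinear V W).2 v)). Qed.

Lemma eq_tlift (U : lmodType k) (f g : V -> W -> U) x :
  f =2 g -> tlift f x = tlift g x.
Proof.
by move=> E; rewrite (_ : f = g) //; apply/funext => v; apply/funext.
Qed.

Variables (U : lmodType k) (f : V -> W -> U).
Hypothesis fB : bilinear_for *:%R *:%R f.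

Lemma tlift_sum (I : finType) (v : I -> V) (w : I -> W) :
  tlift f (\sum_i v i ⊗ w i) = \sum_i f (v i) (w i).
Proof.
rewrite (lin_sum (tlift_linear fB)).
by apply: eq_bigr => i _; rewrite tliftE.
Qed.

End TensorSums.

Section TensorAssociator.
Variables (k : fieldType) (U V W : lmodType k).

Lemma tassoc_linear : linear (@tassoc k U V W).
Proof. exact: tlift_linear (@tassoc_bilin2 k U V W). Qed.

Lemma tassocV_bilin1 (u : U) :
  bilinear_for *:%R *:%R (fun (v : V) (w : W) => (u ⊗ v) ⊗ w).
Proof. by split=> z a x y; rewrite ?(tensZDl, tensZDr). Qed.

Lemma tassocV_bilin2 :
  bilinear_for *:%R *:%R
    (fun (u : U) (y : V ⊗m W) => \tsum_(v, w <- y) (u ⊗ v) ⊗ w).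
Proof.
split=> [y|u]; last exact: tlift_linear (tassocV_bilin1 u).
apply: (tlift_param tassocV_bilin1 _ y) => v w a x y' /=.
by rewrite !tensZDl.
Qed.

Lemma tassocV_linear : linear (@tassocV k U V W).
Proof. exact: tlift_linear tassocV_bilin2. Qed.

Lemma tassocVE (u : U) (v : V) (w : W) :
  tassocV (u ⊗ (v ⊗ w)) = (u ⊗ v) ⊗ w.
Proof.
by rewrite /tassocV (tliftE tassocV_bilin2) (tliftE (tassocV_bilin1 u)).
Qed.

End TensorAssociator.

Section DoubleSweedler.
Variables (k : fieldType) (H : algType k) (Delta : H -> H ⊗m H) (eps : H -> k).
Hypothesis DeltaL : linear Delta.

(* T is a multiplicative matrix in Manin's sense: its entries span a matrix
   subcoalgebra. *)
Definition mult_mx (X : finType) (T : X -> X -> H) : Prop :=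
  (forall x y, Delta (T x y) = \sum_z T x z ⊗ T z y) /\
  (forall x y, eps (T x y) = (x == y)%:R).

Lemma tlift_mult_mx (U : lmodType k) (f : H -> H -> U) (X : finType)
  (T : X -> X -> H) x y : bilinear_for *:%R *:%R f -> mult_mx T ->
  tlift f (Delta (T x y)) = \sum_z f (T x z) (T z y).
Proof. by move=> fB [-> _]; rewrite tlift_sum. Qed.

Variables (U : lmodType k) (E : H -> H -> H -> H -> U).

(** Common shape of the convolution products on H ⊗ H and of both sides of the quasicommutativity
    axiom. *)
Definition sweedler2 (a b : H) : U :=
  \tsum_(a1, a2 <- Delta a) \tsum_(b1, b2 <- Delta b) E a1 a2 b1 b2.

Hypothesis EBl : forall b1 b2,
  bilinear_for *:%R *:%R (fun a1 a2 => E a1 a2 b1 b2).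
Hypothesis EBr : forall a1 a2, bilinear_for *:%R *:%R (E a1 a2).

Lemma sweedler2_bilin b : bilinear_for *:%R *:%R
  (fun a1 a2 => \tsum_(b1, b2 <- Delta b) E a1 a2 b1 b2).
Proof.
split=> z; apply: tlift_param => // b1 b2.
- exact: (EBl b1 b2).1.
- exact: (EBl b1 b2).2.
Qed.

Lemma sweedler2_linear_l b : linear (sweedler2 ^~ b).
Proof. exact: lin_comp (tlift_linear (sweedler2_bilin b)) DeltaL. Qed.

Lemma sweedler2_linear_r a : linear (sweedler2 a).
Proof.
apply: tlift_param => [b|a1 a2]; first exact: sweedler2_bilin.
exact: lin_comp (tlift_linear (EBr a1 a2)) DeltaL.
Qed.

Lemma sweedler2_mult_mx (X Y : finType) (T : X -> X -> H) (S : Y -> Y -> H)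
  x y u v : mult_mx T -> mult_mx S ->
  sweedler2 (T x y) (S u v) =
  \sum_z \sum_w E (T x z) (T z y) (S u w) (S w v).
Proof.
move=> mT mS; rewrite /sweedler2 tlift_mult_mx //; last exact: sweedler2_bilin.
by apply: eq_bigr => z _; rewrite tlift_mult_mx.
Qed.

End DoubleSweedler.

Section Presentation.
Variables (k : fieldType) (n : nat) (H : algType k) (t : 'I_n -> 'I_n -> H).

(** Spanning in the form in which it is used, as an extensionality principle. With [M1_universal]
    and the two families of relations it captures what is used of M1 below, so that an abstract
    algebra H can replace the quotient. *)
Definition spanned_by_words : Prop := forall (U : lmodType k) (f g : H -> U),
  linear f -> linear g ->
  (forall N (x y : widx n N), f (wmx t x y) = g (wmx t x y)) -> f =1 g.

Definition M1_universal (R : tensor_mx k n) (c : 'I_n -> 'I_n -> 'I_n -> k) :=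
  forall (B : lmodType k) (op : B -> B -> B) (one : B),
  bilinear_for *:%R *:%R op -> associative op ->
  left_id one op -> right_id one op ->
  forall L : 'I_n -> 'I_n -> B,
  (forall i j p l,
    \sum_a \sum_b R i a j b *: op (L a p) (L b l) =
    \sum_a \sum_b R a p b l *: op (L j b) (L i a)) ->
  (forall i j p,
    \sum_a c i j a *: L p a = \sum_a \sum_b c a b p *: op (L a i) (L b j)) ->
  exists phi : H -> B,
    [/\ linear phi, phi 1 = one, forall a b, phi (a * b) = op (phi a) (phi b)
      & forall i j, phi (t i j) = L i j].

End Presentation.

(** * The bialgebra structure *)

Section MatrixBialgebra.
Variables (k : fieldType) (n : nat) (R : tensor_mx k n).
Variable (c : 'I_n -> 'I_n -> 'I_n -> k).
Variables (H : algType k) (t : 'I_n -> 'I_n -> H).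

Hypothesis t_RTT : forall i j p l,
  \sum_a \sum_b R i a j b *: (t a p * t b l) =
  \sum_a \sum_b R a p b l *: (t j b * t i a).
Hypothesis t_alg : forall i j p,
  \sum_a c i j a *: t p a = \sum_a \sum_b c a b p *: (t a i * t b j).
Hypothesis t_ext : spanned_by_words t.
Hypothesis t_lift : M1_universal t R c.

Section MultMatrices.
Variables (Delta : H -> H ⊗m H) (eps : H -> k).
Hypothesis Delta1 : Delta 1 = 1.
Hypothesis DeltaM : forall a b, Delta (a * b) = Delta a * Delta b.
Hypothesis Delta_t : forall i j, Delta (t i j) = \sum_a t i a ⊗ t a j.
Hypothesis eps1 : eps 1 = 1.
Hypothesis epsM : forall a b, eps (a * b) = eps a * eps b.
Hypothesis eps_t : forall i j, eps (t i j) = (i == j)%:R.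

Lemma mult_mx1 : mult_mx Delta eps (fun _ _ : unit => 1).
Proof.
split=> [] [] []; last by rewrite eps1.
by rewrite Delta1 sum_unit tens1.
Qed.

Lemma mult_mx_gen : mult_mx Delta eps t.
Proof. by []. Qed.

Lemma mult_mxM (X Y : finType) (T : X -> X -> H) (S : Y -> Y -> H) :
  mult_mx Delta eps T -> mult_mx Delta eps S ->
  mult_mx Delta eps (fun x y : X * Y => T x.1 y.1 * S x.2 y.2).
Proof.
move=> [DT eT] [DS eS]; split=> [] [x u] [y v] /=.
  rewrite DeltaM DT DS big_distrlr pair_bigA /=.
  by apply: eq_bigr => z _; exact: tensM.
by rewrite epsM eT eS -natrM mulnb.
Qed.

Lemma mult_wmx N : mult_mx Delta eps (@wmx n H t N).
Proof.
elim: N => [|N IH]; first exact: mult_mx1.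
exact: mult_mxM mult_mx_gen IH.
Qed.

End MultMatrices.

Lemma tens_mul_bilin :
  bilinear_for *:%R *:%R (@GRing.mul (H ⊗m H)).
Proof.
split=> z.
  exact: tens_mul_linl (alg_mul_bilinear H) (alg_mul_bilinear H) z.
exact: tens_mul_linr (alg_mul_bilinear H) (alg_mul_bilinear H) z.
Qed.

Let D i j : H ⊗m H := \sum_a t i a ⊗ t a j.

Let DM i j p l : D i j * D p l =
  \sum_a \sum_b (t i a * t p b) ⊗ (t a j * t b l).
Proof.
rewrite /D big_distrlr /=; apply: eq_bigr => a _.
by apply: eq_bigr => b _; rewrite tensM.
Qed.

(** The matrix [D] of coproducts satisfies the relations because each relation can be applied in the
    two tensor factors one after the other. *)
Lemma exists_Delta : exists Delta : H -> H ⊗m H,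
  [/\ linear Delta, Delta 1 = 1, forall a b, Delta (a * b) = Delta a * Delta b
    & forall i j, Delta (t i j) = \sum_a t i a ⊗ t a j].
Proof.
apply: (@t_lift _ _ _ tens_mul_bilin (@mulrA _) (@mul1r _) (@mulr1 _) D).
- move=> i j p l.
  (* R stands next to the row indices, which lie in the left factor: it passes the left factor first
     and then the right one. *)
  transitivity (\sum_d \sum_e
      (\sum_a \sum_b R i a j b *: (t a d * t b e)) ⊗ (t d p * t e l)).
    under eq_bigr => a _.
      under eq_bigr => b _.
        rewrite DM scaler_sumr; under eq_bigr do rewrite scaler_sumr.
      over.
      rewrite exchange_big; under eq_bigr do rewrite exchange_big.
    over.
    rewrite exchange_big; apply: eq_bigr => d _.
    rewrite exchange_big; apply: eq_bigr => e _.
    rewrite tens_suml; apply: eq_bigr => a _.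
    by rewrite tens_suml; apply: eq_bigr => b _; rewrite tensZl.
  transitivity (\sum_a \sum_b
      (t j b * t i a) ⊗ (\sum_d \sum_e R a d b e *: (t d p * t e l))).
    under eq_bigr => d _.
      under eq_bigr => e _.
        rewrite t_RTT tens_suml; under eq_bigr do rewrite tens_suml.
      over.
      rewrite exchange_big; under eq_bigr do rewrite exchange_big.
    over.
    rewrite exchange_big; apply: eq_bigr => a _.
    rewrite exchange_big; apply: eq_bigr => b _.
    rewrite tens_sumr; apply: eq_bigr => d _.
    by rewrite tens_sumr; apply: eq_bigr => e _; rewrite tensZl tensZr.
  under eq_bigr => a _.
    under eq_bigr => b _.
      rewrite t_RTT tens_sumr; under eq_bigr do rewrite tens_sumr.
    over.
    rewrite exchange_big; under eq_bigr do rewrite exchange_big.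
  over.
  rewrite exchange_big; apply: eq_bigr => d _.
  rewrite exchange_big; apply: eq_bigr => e _.
  rewrite DM scaler_sumr exchange_big; apply: eq_bigr => b _.
  by rewrite scaler_sumr; apply: eq_bigr => a _; rewrite tensZr.
move=> i j p.
(* Here c is contracted with the column index, which lies in the right factor, so the relation is
   used there first. *)
transitivity (\sum_d t p d ⊗ (\sum_a c i j a *: t d a)).
  under eq_bigr do rewrite scaler_sumr.
  rewrite exchange_big; apply: eq_bigr => d _.
  by rewrite tens_sumr; apply: eq_bigr => a _; rewrite tensZr.
transitivity (\sum_a \sum_b (\sum_d c a b d *: t p d) ⊗ (t a i * t b j)).
  under eq_bigr => d _.
    rewrite t_alg tens_sumr; under eq_bigr do rewrite tens_sumr.
  over.
  rewrite exchange_big; apply: eq_bigr => a _.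
  rewrite exchange_big; apply: eq_bigr => b _.
  by rewrite tens_suml; apply: eq_bigr => d _; rewrite tensZl tensZr.
under eq_bigr => a _.
  under eq_bigr => b _.
    rewrite t_alg tens_suml; under eq_bigr do rewrite tens_suml.
  over.
  rewrite exchange_big; under eq_bigr do rewrite exchange_big.
over.
rewrite exchange_big; apply: eq_bigr => d _.
rewrite exchange_big; apply: eq_bigr => e _.
rewrite DM scaler_sumr; apply: eq_bigr => a _.
by rewrite scaler_sumr; apply: eq_bigr => b _; rewrite tensZl.
Qed.

Lemma exists_eps : exists eps : H -> k,
  [/\ scalar eps, eps 1 = 1, forall a b, eps (a * b) = eps a * eps b
    & forall i j, eps (t i j) = (i == j)%:R].
Proof.
apply: (@t_lift k^o *%R 1 (alg_mul_bilinear _) (@mulrA _) (@mul1r _)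
  (@mulr1 _) (fun i j => (i == j)%:R)).
- move=> i j p l; rewrite /GRing.scale /=.
  transitivity (R i p j l).
    under eq_bigr => a _ do under eq_bigr do rewrite mulrA.
    under eq_bigr do rewrite sum_kidr.
    by rewrite sum_kidr.
  under eq_bigr => a _.
    under eq_bigr do rewrite mulrCA.
    rewrite sum_kid.
  over.
  by under eq_bigr do rewrite mulrC; rewrite sum_kid.
move=> i j p; rewrite /GRing.scale /=.
under eq_bigr do rewrite mulrC.
rewrite sum_kid; under eq_bigr => a _ do under eq_bigr do rewrite mulrA.
by under eq_bigr do rewrite sum_kidr; rewrite sum_kidr.
Qed.

(** Coassociativity and the counit laws are linear, so they are checked on word entries, where they
    become associativity and unit laws of matrix multiplication. *)
Lemma exists_bialgebra : exists (Delta : H -> H ⊗m H) (eps : H -> k),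
  [/\ bialgebra Delta eps,
      forall i j, Delta (t i j) = \sum_a t i a ⊗ t a j
    & forall i j, eps (t i j) = (i == j)%:R].
Proof.
have [Delta [DL D1 DM' Dt]] := exists_Delta.
have [eps [eL e1 eM et]] := exists_eps.
exists Delta, eps; split=> //.
have mW := mult_wmx D1 DM' Dt e1 eM et.
have DidB : bilinear_for *:%R *:%R (fun u v : H => Delta u ⊗ v).
  by split=> z a x y; rewrite ?DL (tensZDl, tensZDr).
have idDB : bilinear_for *:%R *:%R (fun u v : H => u ⊗ Delta v).
  by split=> z a x y; rewrite ?DL (tensZDl, tensZDr).
have elB : bilinear_for *:%R *:%R (fun u v : H => eps u *: v).
  split=> z a x y /=; first by rewrite eL scalerDl scalerA.
  by rewrite scalerDr !scalerA mulrC.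
have erB : bilinear_for *:%R *:%R (fun u v : H => eps v *: u).
  split=> z a x y /=; last by rewrite eL scalerDl scalerA.
  by rewrite scalerDr !scalerA mulrC.
have tassocL : linear (@tassoc k H H H) by exact: tassoc_linear.
split=> //.
- apply: t_ext => [||N x y].
  + exact: lin_comp tassocL (lin_comp (tlift_linear DidB) DL).
  + exact: lin_comp (tlift_linear idDB) DL.
  rewrite /tmap (tlift_mult_mx _ _ DidB (mW N)) (tlift_mult_mx _ _ idDB (mW N)).
  rewrite (lin_sum tassocL).
  under eq_bigr => z _.
    rewrite (mW N).1 tens_suml (lin_sum tassocL).
    under eq_bigr do rewrite tassocE.
  over.
  rewrite exchange_big; apply: eq_bigr => z _.
  by rewrite (mW N).1 tens_sumr.
- apply: t_ext => [||N x y].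
  + exact: lin_comp (tlift_linear elB) DL.
  + exact: lin_id.
  rewrite (tlift_mult_mx _ _ elB (mW N)).
  rewrite (bigD1 x) //= (mW N).2 eqxx scale1r big1 ?addr0 // => z /negPf.
  by rewrite (mW N).2 eq_sym => ->; rewrite scale0r.
- apply: t_ext => [||N x y].
  + exact: lin_comp (tlift_linear erB) DL.
  + exact: lin_id.
  rewrite (tlift_mult_mx _ _ erB (mW N)).
  rewrite (bigD1 y) //= (mW N).2 eqxx scale1r big1 ?addr0 // => z /negPf.
  by rewrite (mW N).2 => ->; rewrite scale0r.
Qed.

End MatrixBialgebra.

(** * Pairings on M1 *)

Section Dual.
Variables (k : fieldType) (V : lmodType k).

(** Linearity is recorded as a boolean, so that forms with the same values are equal. *)
Record dual := Dual {
  dual_fun :> V -> k;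
  dual_subproof : `[< scalar dual_fun >]
}.
HB.instance Definition _ := [isSub for dual_fun].
HB.instance Definition _ := [Choice of dual by <:].

Implicit Types f g : dual.

Lemma dualL f : scalar f.
Proof. exact/asboolP/dual_subproof. Qed.

Lemma dualP f g : f =1 g -> f = g.
Proof. by move=> E; apply: val_inj; apply: funext. Qed.

Definition dual_of (f : V -> k) (fL : scalar f) : dual :=
  Dual (introT (asboolP _) fL).

Fact dual_zero_subproof : scalar (fun _ : V => 0 : k).
Proof. by move=> a u v; rewrite mulr0 addr0. Qed.
Fact dual_opp_subproof f : scalar (fun x => - f x).
Proof. by move=> a u v; rewrite dualL opprD mulrN. Qed.
Fact dual_add_subproof f g : scalar (fun x => f x + g x).
Proof. by move=> a u v; rewrite !dualL mulrDr addrACA. Qed.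
Fact dual_scale_subproof a f : scalar (fun x => a * f x).
Proof. by move=> b u v; rewrite dualL mulrDr mulrCA. Qed.

Definition dual_zero := dual_of dual_zero_subproof.
Definition dual_opp f := dual_of (dual_opp_subproof f).
Definition dual_add f g := dual_of (dual_add_subproof f g).
Definition dual_scale a f := dual_of (dual_scale_subproof a f).

Fact dual_addA : associative dual_add.
Proof. by move=> f g h; apply: dualP => x /=; rewrite addrA. Qed.
Fact dual_addC : commutative dual_add.
Proof. by move=> f g; apply: dualP => x /=; rewrite addrC. Qed.
Fact dual_add0 : left_id dual_zero dual_add.
Proof. by move=> f; apply: dualP => x /=; rewrite add0r. Qed.
Fact dual_addN : left_inverse dual_zero dual_opp dual_add.
Proof. by move=> f; apply: dualP => x /=; rewrite addNr. Qed.

HB.instance Definition _ := GRing.isZmodule.Build dual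
  dual_addA dual_addC dual_add0 dual_addN.

Fact dual_scaleA a b f :
  dual_scale a (dual_scale b f) = dual_scale (a * b) f.
Proof. by apply: dualP => x /=; rewrite mulrA. Qed.
Fact dual_scale1 : left_id 1 dual_scale.
Proof. by move=> f; apply: dualP => x /=; rewrite mul1r. Qed.
Fact dual_scaleDr : right_distributive dual_scale +%R.
Proof. by move=> a f g; apply: dualP => x /=; rewrite mulrDr. Qed.
Fact dual_scaleDl f : {morph dual_scale^~ f : a b / a + b}.
Proof. by move=> a b; apply: dualP => x /=; rewrite mulrDl. Qed.

HB.instance Definition _ := GRing.Zmodule_isLmodule.Build k dual
  dual_scaleA dual_scale1 dual_scaleDr dual_scaleDl.

Lemma dual_scaleE a f x : (a *: f) x = a * f x.
Proof. by []. Qed.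

Lemma dual_sumE (I : finType) (F : I -> dual) x :
  (\sum_i F i) x = \sum_i F i x.
Proof. exact: (lin_sum (V := k^o) (f := fun f : dual => f x)). Qed.

Lemma dual_evalE a f g x : (a *: f + g) x = a * f x + g x.
Proof. by []. Qed.

End Dual.

Section Pairing.
Variables (k : fieldType) (n : nat) (R : tensor_mx k n).
Variable (c : 'I_n -> 'I_n -> 'I_n -> k).
Variables (H : algType k) (t : 'I_n -> 'I_n -> H).
Hypothesis t_ext : spanned_by_words t.
Hypothesis t_lift : M1_universal t R c.
Variables (Delta : H -> H ⊗m H) (eps : H -> k).
Hypothesis bialg : bialgebra Delta eps.
Hypothesis Delta_t : forall i j, Delta (t i j) = \sum_a t i a ⊗ t a j.
Hypothesis eps_t : forall i j, eps (t i j) = (i == j)%:R.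

Let DL : linear Delta := Delta_linear bialg.
Let eL : scalar eps := eps_linear bialg.
Local Notation mult := (mult_mx Delta eps).

Let mT : mult t. Proof. by []. Qed.
Let mW N : mult (@wmx n H t N).
Proof.
exact: mult_wmx (Delta1 bialg) (DeltaM bialg) Delta_t (eps1 bialg)
  (epsM bialg) eps_t N.
Qed.
Let mM (X Y : finType) (T : X -> X -> H) (S : Y -> Y -> H) :
  mult T -> mult S -> mult (fun x y : X * Y => T x.1 y.1 * S x.2 y.2).
Proof. exact: mult_mxM (DeltaM bialg) (epsM bialg) _ _ _ _. Qed.

(* The two Sweedler identities of a bialgebra pairing, stated at the entries of
   multiplicative matrices, where they are finite sums. *)
Record pairing (r : H -> H -> k) : Prop := {
  pairing_bilin : bilinear_for *:%R *:%R (r : H -> H -> k^o);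
  pairing1l : forall b, r 1 b = eps b;
  pairing1r : forall a, r a 1 = eps a;
  pairingMl : forall (Y : finType) (S : Y -> Y -> H), mult S ->
    forall a b u v, r (a * b) (S u v) = \sum_w r a (S u w) * r b (S w v);
  pairingMr : forall (X : finType) (T : X -> X -> H), mult T ->
    forall b c x y, r (T x y) (b * c) = \sum_z r (T x z) c * r (T z y) b
}.

(** * The convolution algebra of linear forms *)

Section Convolution.
Implicit Types f g h : dual H.

Lemma convol_bilin f g : bilinear_for *:%R *:%R (fun x y => f x * g y : k^o).
Proof.
split=> z a x y; rewrite dualL; first by rewrite mulrDl -mulrA.
by rewrite mulrDr mulrCA.
Qed.

Fact convol_subproof f g :
  scalar (fun x => \tsum_(x1, x2 <- Delta x) (f x1 * g x2 : k^o)).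
Proof. exact: lin_comp (tlift_linear (convol_bilin f g)) DL. Qed.

(** On the entries of a multiplicative matrix this is the product of the matrices of values, and the
    algebra laws below, with unit [eps], are read off there. *)
Definition convol f g : dual H := dual_of (convol_subproof f g).

Lemma convolE f g (X : finType) (T : X -> X -> H) x y : mult T ->
  convol f g (T x y) = \sum_z f (T x z) * g (T z y).
Proof. exact: tlift_mult_mx (convol_bilin f g). Qed.

Lemma dual_ext f g :
  (forall N (x y : widx n N), f (wmx t x y) = g (wmx t x y)) -> f = g.
Proof.
by move=> E; apply/dualP/(t_ext (U := k^o)) => //; exact: dualL.
Qed.

Lemma convol_is_bilin : bilinear_for *:%R *:%R convol.
Proof.
split=> h a f g; apply: dual_ext => N x y; rewrite dual_evalE !convolE //.
  rewrite mulr_sumr -big_split; apply: eq_bigr => z _.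
  by rewrite dual_evalE mulrDl mulrA.
rewrite mulr_sumr -big_split; apply: eq_bigr => z _.
by rewrite dual_evalE mulrDr mulrCA.
Qed.

Lemma convolA : associative convol.
Proof.
move=> f g h; apply: dual_ext => N x y; rewrite !convolE //.
under eq_bigr do rewrite convolE // mulr_sumr.
rewrite exchange_big; apply: eq_bigr => z _; rewrite convolE // mulr_suml.
by apply: eq_bigr => w _; rewrite mulrA.
Qed.

Lemma convol1l : left_id (dual_of eL) convol.
Proof.
move=> f; apply: dual_ext => N x y; rewrite convolE //=.
by under eq_bigr do rewrite (mW N).2; rewrite sum_kid.
Qed.

Lemma convol1r : right_id (dual_of eL) convol.
Proof.
move=> f; apply: dual_ext => N x y; rewrite convolE //=.
by under eq_bigr do rewrite (mW N).2; rewrite sum_kidr.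
Qed.

End Convolution.

(* The values Q^i_j^k_l of a pairing at t^i_j ⊗ t^k_l respect the relations of
   the first (l) and of the second (r) tensor factor. *)
Record pairing_data (Q : tensor_mx k n) : Prop := {
  Ql_RTT : forall i j p l m q,
    \sum_a \sum_b R i a j b * (\sum_s Q a p m s * Q b l s q) =
    \sum_a \sum_b R a p b l * (\sum_s Q j b m s * Q i a s q);
  Ql_alg : forall i j p m q,
    \sum_a c i j a * Q p a m q =
    \sum_a \sum_b c a b p * (\sum_s Q a i m s * Q b j s q);
  Qr_RTT : forall i j p l m q,
    \sum_a \sum_b R i a j b * (\sum_s Q m s b l * Q s q a p) =
    \sum_a \sum_b R a p b l * (\sum_s Q m s i a * Q s q j b);
  Qr_alg : forall i j p m q,
    \sum_a c i j a * Q m q p a =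
    \sum_a \sum_b c a b p * (\sum_s Q m s b j * Q s q a i)
}.

(** * The pairing with prescribed values on the generators *)

Section Construction.
Variable Q : tensor_mx k n.
Hypothesis hQ : pairing_data Q.

(** The matrix [s a] is to hold the values r(t^m_q, a). The rule for a product in the second
    argument reverses the order, so the universal property is applied to matrices with the reversed
    product; [Qr_RTT] and [Qr_alg] are the relations it asks for. *)
Lemma exists_second_rep : exists s : H -> 'M[k]_n,
  [/\ linear s, s 1 = 1%:M, forall a b, s (a * b) = s b *m s a
    & forall i j, s (t i j) = \matrix_(m, q) Q m q i j].
Proof.
apply: (@t_lift _ (fun X Y => Y *m X) 1%:M _ _ _ _
  (fun i j => \matrix_(m, q) Q m q i j)).
- by split=> z a x y; rewrite (mulmxDr, mulmxDl) -(scalemxAl, scalemxAr).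
- by move=> x y z; rewrite mulmxA.
- by move=> x; rewrite mulmx1.
- by move=> x; rewrite mul1mx.
- move=> i j p l; apply/matrixP => m q; rewrite !summxE.
  under eq_bigr => a _.
    rewrite summxE; under eq_bigr => b _.
      rewrite !mxE; under eq_bigr do rewrite !mxE.
    over.
  over.
  rewrite (Qr_RTT hQ); apply: eq_bigr => a _.
  rewrite summxE; apply: eq_bigr => b _; rewrite !mxE; congr (_ * _).
  by apply: eq_bigr => s _; rewrite !mxE.
move=> i j p; apply/matrixP => m q; rewrite !summxE.
under eq_bigr do rewrite !mxE.
rewrite (Qr_alg hQ); apply: eq_bigr => a _.
rewrite summxE; apply: eq_bigr => b _; rewrite !mxE; congr (_ * _).
by apply: eq_bigr => s _; rewrite !mxE.
Qed.

Section Forms.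
Variable s : H -> 'M[k]_n.
Hypothesis sL : linear s.
Hypothesis s1 : s 1 = 1%:M.
Hypothesis sM : forall a b, s (a * b) = s b *m s a.
Hypothesis s_t : forall i j, s (t i j) = \matrix_(m, q) Q m q i j.

Fact gform_subproof i j : scalar (fun x => s x i j).
Proof. by move=> a u v; rewrite sL !mxE. Qed.

(** The future form r(t^i_j, -). *)
Definition gform i j : dual H := dual_of (gform_subproof i j).

Local Notation I2 := ('I_n * 'I_n)%type.

(** The value at S_uv of the convolution product of [gform x.1 y.1] and [gform x.2 y.2]. Read as a
    matrix in x and y, it turns the relations between the forms into intertwining relations. *)
Definition gform2 (Y : finType) (S : Y -> Y -> H) u v (x y : I2) : k :=
  \sum_w s (S u w) x.1 y.1 * s (S w v) x.2 y.2.

(** The factors come out in reverse order because [s] is antimultiplicative. *)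
Lemma gform2M (Y Y' : finType) (S : Y -> Y -> H) (S' : Y' -> Y' -> H) u v :
  gform2 (fun x y : Y * Y' => S x.1 y.1 * S' x.2 y.2) u v =2
  mulk (gform2 S' u.2 v.2) (gform2 S u.1 v.1).
Proof.
move=> x y; rewrite /gform2 /mulk.
rewrite -(sum_shuffle (fun e w' => s (S' u.2 w') x.1 e)
  (fun e w => s (S u.1 w) e y.1) (fun g w' => s (S' w' v.2) x.2 g)
  (fun g w => s (S w v.1) g y.2)).
by apply: eq_bigr => w _; rewrite !sM !mxE.
Qed.

(** Conjugation by the flip of the two tensor factors. *)
Definition swap2 (f : I2 -> I2 -> k) (x y : I2) : k :=
  f (x.2, x.1) (y.2, y.1).

Lemma mulk_swap2 (f g : I2 -> I2 -> k) :
  mulk (swap2 f) (swap2 g) =2 swap2 (mulk f g).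
Proof.
move=> x y; rewrite /mulk /swap2.
rewrite (reindex_inj (h := fun z : I2 => (z.2, z.1))) //=.
  by apply: eq_bigr => -[].
by move=> [? ?] [? ?] [-> ->].
Qed.

Lemma convol_gform a b p l N (u v : widx n N) :
  convol (gform a p) (gform b l) (wmx t u v) =
  gform2 (@wmx n H t N) u v (a, b) (p, l).
Proof. exact: convolE. Qed.

Lemma gform2_1 u v : gform2 (fun _ _ : unit => 1) u v =2 @kid k _.
Proof.
move=> x y; rewrite /gform2 sum_unit.
by rewrite s1 !mxE -natrM mulnb.
Qed.

Lemma gform2_t m q x y :
  gform2 t m q x y = \sum_s Q x.1 y.1 m s * Q x.2 y.2 s q.
Proof. by apply: eq_bigr => w _; rewrite !s_t !mxE. Qed.

(** R intertwines the matrix of a single letter with its flip, by [Ql_RTT]. The matrix of a word is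
    a product of such matrices by [gform2M], and intertwining relations pass to products. *)
Lemma gform_RTT N (u v : widx n N) :
  mulk (op2 R) (gform2 (@wmx n H t N) u v) =2
  mulk (swap2 (gform2 (@wmx n H t N) u v)) (op2 R).
Proof.
elim: N => [|N IH] in u v * => x y.
  rewrite (eq_mulk (fun _ _ => erefl) (gform2_1 u v)) mulk1r.
  rewrite (eq_mulk (f' := @kid k _) _ (fun _ _ => erefl)) ?mulk1l // => z w.
  by rewrite /swap2 gform2_1 /kid -!pair_eqE /= /pair_eq /= andbC.
pose K := gform2 t u.1 v.1; pose K' := gform2 (@wmx n H t N) u.2 v.2.
have KR : mulk (op2 R) K =2 mulk (swap2 K) (op2 R).
  move=> z w; rewrite /mulk.
  under eq_bigr do rewrite /K gform2_t.
  under [RHS]eq_bigr do rewrite /swap2 /K gform2_t mulrC.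
  rewrite -(pair_bigA _ (fun a b =>
    R z.1 a z.2 b * \sum_s Q a w.1 u.1 s * Q b w.2 s v.1)).
  rewrite -(pair_bigA _ (fun a b =>
    R a w.1 b w.2 * \sum_s Q z.2 b u.1 s * Q z.1 a s v.1)).
  exact: Ql_RTT.
rewrite (eq_mulk (fun _ _ => erefl) (gform2M t (@wmx n H t N) u v)) mulkA.
rewrite (eq_mulk (IH _ _) (fun _ _ => erefl)) -mulkA.
rewrite (eq_mulk (fun _ _ => erefl) KR) mulkA.
apply: eq_mulk => // z w; rewrite mulk_swap2 /swap2.
by rewrite (gform2M t (@wmx n H t N)).
Qed.

Definition ctens (p : 'I_n) (ij : I2) : k := c ij.1 ij.2 p.

(** The same induction on words, with the structure constants as the intertwiner and [Ql_alg] on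
    single letters. *)
Lemma gform_alg N (u v : widx n N) :
  mulk (fun_of_matrix (s (wmx t u v))) ctens =2
  mulk ctens (gform2 (@wmx n H t N) u v).
Proof.
elim: N => [|N IH] in u v * => x y.
  rewrite [RHS](eq_mulk (fun _ _ => erefl) (gform2_1 u v)) mulk1r.
  rewrite (eq_mulk (f' := @kid k _) _ (fun _ _ => erefl)) ?mulk1l // => z w.
  by rewrite /= s1 !mxE.
pose K := gform2 t u.1 v.1.
have KC : mulk (fun_of_matrix (s (t u.1 v.1))) ctens =2 mulk ctens K.
  move=> z w; rewrite /mulk /ctens.
  under eq_bigr do rewrite s_t mxE mulrC.
  under [RHS]eq_bigr do rewrite /K gform2_t.
  rewrite -(pair_bigA _ (fun a b =>
    c a b z * \sum_s Q a w.1 u.1 s * Q b w.2 s v.1)).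
  exact: Ql_alg.
rewrite [RHS](eq_mulk (fun _ _ => erefl) (gform2M t (@wmx n H t N) u v)) mulkA.
rewrite -[RHS](eq_mulk (IH _ _) (fun _ _ => erefl)) -mulkA.
rewrite -[RHS](eq_mulk (fun _ _ => erefl) KC) mulkA.
by apply: eq_mulk => // z w; rewrite /= sM mxE.
Qed.

Lemma exists_dual_hom : exists phi : H -> dual H,
  [/\ linear phi, phi 1 = dual_of eL,
      forall a b, phi (a * b) = convol (phi a) (phi b)
    & forall i j, phi (t i j) = gform i j].
Proof.
apply: (@t_lift _ _ _ convol_is_bilin convolA convol1l convol1r gform).
- move=> i j p l; apply: dual_ext => N u v.
  have := gform_RTT u v (i, j) (p, l); rewrite /mulk !sum_pair /= => E.
  rewrite !dual_sumE; apply: (etrans _ (etrans E _)).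
    apply: eq_bigr => a _; rewrite dual_sumE; apply: eq_bigr => b _.
    by rewrite dual_scaleE convol_gform.
  apply: eq_bigr => a _; rewrite dual_sumE; apply: eq_bigr => b _.
  by rewrite dual_scaleE convol_gform mulrC.
move=> i j p; apply: dual_ext => N u v.
have := gform_alg u v p (i, j); rewrite /mulk !sum_pair /= => E.
rewrite !dual_sumE; apply: (etrans _ (etrans E _)); apply: eq_bigr => a _.
  by rewrite dual_scaleE mulrC.
rewrite dual_sumE; apply: eq_bigr => b _.
by rewrite dual_scaleE convol_gform.
Qed.

End Forms.
(** With r(a, b) = phi(a)(b), the product rule in the first argument is multiplicativity of [phi].
    The rule in the second argument is at first known only against generators, through [s], and is
    extended to words by induction. *)
Lemma exists_pairing : exists2 r, pairing r &
  forall i j p q, r (t i j) (t p q) = Q i j p q.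
Proof.
have [s [sL s1 sM s_t]] := exists_second_rep.
have [phi [phiL phi1 phiM phi_t]] := exists_dual_hom sL s1 sM s_t.
have [r rE] : exists r : H -> H -> k, forall a b, r a b = phi a b.
  by exists (fun a b => phi a b).
have rB : bilinear_for *:%R *:%R (r : H -> H -> k^o).
  by split=> z a x y; rewrite !rE; [rewrite phiL|rewrite dualL].
have rMl (Y : finType) (S : Y -> Y -> H) (mS : mult S) a b u v :
    r (a * b) (S u v) = \sum_w r a (S u w) * r b (S w v).
  rewrite rE phiM (convolE _ _ _ _ mS).
  by apply: eq_bigr => w _; rewrite !rE.
have r_t i j a : r (t i j) a = s a i j by rewrite rE phi_t.
have r1l a : r 1 a = eps a by rewrite rE phi1.
have r1r a : r a 1 = eps a.
  move: a; apply: (t_ext (U := k^o)) => [||N]; [exact: rB.1|exact: eL|].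
  elim: N => [|N IH] x y; first exact: r1l.
  (* The unit is the entry of a 1 x 1 multiplicative matrix, so the rule for the first argument
     applies to it. *)
  rewrite /= (rMl _ _ (mult_mx1 (Delta1 bialg) (eps1 bialg)) _ _ tt tt).
  rewrite sum_unit /=.
  by rewrite IH r_t s1 mxE (epsM bialg) eps_t.
(* Word entries suffice: in its Sweedler form the identity is linear in all arguments, hence extends
   from words to all of H, and is then evaluated on an arbitrary multiplicative matrix. *)
suff rMr N N1 N2 (x y : widx n N) (u v : widx n N1) (u' v' : widx n N2) :
    r (wmx t x y) (wmx t u v * wmx t u' v') =
    \sum_z r (wmx t x z) (wmx t u' v') * r (wmx t z y) (wmx t u v).
  exists r; last by move=> i j p q; rewrite r_t s_t mxE.
  split=> // X T mTX b b' x y.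
  have GB d d' : bilinear_for *:%R *:%R (fun a1 a2 => r a1 d' * r a2 d : k^o).
    split=> z a u v /=.
      by have /= -> := rB.1 d' a u v; rewrite mulrDl -mulrA.
    by have /= -> := rB.1 d a u v; rewrite mulrDr mulrCA.
  suff E a : r a (b * b') = \tsum_(a1, a2 <- Delta a) (r a1 b' * r a2 b : k^o).
    by rewrite E; exact: (tlift_mult_mx _ _ (GB b b') mTX).
  move: a; apply: (t_ext (U := k^o)) => [||N].
  - exact: rB.1.
  - exact: lin_comp (tlift_linear (GB b b')) DL.
  move=> {}x {}y; rewrite (tlift_mult_mx _ _ (GB b b') (mW N)).
  move: b; apply: (t_ext (U := k^o)) => [||N1 u v].
  - exact: lin_comp (rB.2 _) ((alg_mul_bilinear H).1 b').
  - move=> a z w; rewrite scaler_sumr -big_split; apply: eq_bigr => q _ /=.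
    by have /= -> := rB.2 (wmx t q y) a z w; rewrite mulrDr mulrCA.
  move: b'; apply: (t_ext (U := k^o)) => [||N2 u' v'].
  - exact: lin_comp (rB.2 _) ((alg_mul_bilinear H).2 _).
  - move=> a z w; rewrite scaler_sumr -big_split; apply: eq_bigr => q _ /=.
    by have /= -> := rB.2 (wmx t x q) a z w; rewrite mulrDl -mulrA.
  exact: rMr.
(* Induction on the word in the first argument: its first letter is handled by antimultiplicativity
   of [s], the remaining ones by the induction hypothesis, and [sum_shuffle] regroups the two. *)
elim: N => [|N IH] in x y u v u' v' *.
  rewrite sum_unit /=.
  by rewrite !r1l (epsM bialg) mulrC.
rewrite /= (rMl _ _ (mM (mW N1) (mW N2)) _ _ (u, u') (v, v')) /=.
transitivity (\sum_w (\sum_e s (wmx t u' w.2) x.1 e * s (wmx t u w.1) e y.1) *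
    (\sum_z r (wmx t x.2 z) (wmx t w.2 v') * r (wmx t z y.2) (wmx t w.1 v))).
  by apply: eq_bigr => w _; rewrite IH r_t sM mxE.
rewrite (sum_shuffle (fun e w' => s (wmx t u' w') x.1 e)
  (fun e w => s (wmx t u w) e y.1)
  (fun z w' => r (wmx t x.2 z) (wmx t w' v'))
  (fun z w => r (wmx t z y.2) (wmx t w v))).
apply: eq_bigr => z _; rewrite (rMl _ _ (mW N2)) (rMl _ _ (mW N1)).
by congr (_ * _); apply: eq_bigr => w _; rewrite r_t.
Qed.

End Construction.

End Pairing.

(* A strand s passes the product of two strands u, u', one crossing at a time.
   Stated for a bare operation so that it also applies to the opposite
   product. *)
Lemma zipper (k : fieldType) (H : lmodType k) (op : H -> H -> H)
  (opB : bilinear_for *:%R *:%R op) (opA : associative op)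
  (Z Z' W : finType) (f : Z -> W -> W -> k) (f' : Z' -> W -> k)
  (g : Z -> W -> k) (g' : Z' -> W -> W -> k) (s s3 : W -> H) (s2 : W -> W -> H)
  (u u2 : Z -> H) (u' u2' : Z' -> H) :
  (forall q, \sum_z \sum_w f z w q *: op (s w) (u z) =
             \sum_z \sum_w g z w *: op (u2 z) (s2 w q)) ->
  (forall w, \sum_z' \sum_q f' z' q *: op (s2 w q) (u' z') =
             \sum_z' \sum_q g' z' w q *: op (u2' z') (s3 q)) ->
  \sum_z \sum_z' \sum_w
    (\sum_q f z w q * f' z' q) *: op (s w) (op (u z) (u' z')) =
  \sum_z \sum_z' \sum_q
    (\sum_w g z w * g' z' w q) *: op (op (u2 z) (u2' z')) (s3 q).
Proof.
move=> E1 E2.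
transitivity (\sum_z' \sum_q f' z' q *:
    op (\sum_z \sum_w f z w q *: op (s w) (u z)) (u' z')).
  rewrite exchange_big; apply: eq_bigr => z' _.
  under [RHS]eq_bigr => q _.
    rewrite (lin_sumZ2 (opB.1 _)) scaler_sumr.
    under eq_bigr do rewrite scaler_sumr.
  over.
  rewrite [RHS]exchange_big; apply: eq_bigr => z _.
  rewrite [RHS]exchange_big; apply: eq_bigr => w _.
  rewrite scaler_suml; apply: eq_bigr => q _.
  by rewrite opA scalerA mulrC.
transitivity (\sum_z \sum_w g z w *:
    op (u2 z) (\sum_z' \sum_q f' z' q *: op (s2 w q) (u' z'))).
  under eq_bigr => z' _.
    under eq_bigr => q _.
      rewrite E1 (lin_sumZ2 (opB.1 _)) scaler_sumr.
      under eq_bigr do rewrite scaler_sumr.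
    over.
    rewrite exchange_big; under eq_bigr do rewrite exchange_big.
  over.
  rewrite exchange_big; apply: eq_bigr => z _.
  rewrite exchange_big; apply: eq_bigr => w _.
  rewrite (lin_sumZ2 (opB.2 _)) scaler_sumr; apply: eq_bigr => z' _.
  rewrite scaler_sumr; apply: eq_bigr => q _.
  by rewrite -opA !scalerA mulrC.
apply: eq_bigr => z _.
under eq_bigr => w _.
  rewrite E2 (lin_sumZ2 (opB.2 _)) scaler_sumr.
  under eq_bigr do rewrite scaler_sumr.
over.
rewrite exchange_big; apply: eq_bigr => z' _.
rewrite exchange_big; apply: eq_bigr => q _.
rewrite scaler_suml; apply: eq_bigr => w _.
by rewrite opA scalerA.
Qed.

(** * Inversion, quasicommutativity and the dual quasitriangular structure *)

Section DualQuasitriangular.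
Variables (k : fieldType) (n : nat) (R : tensor_mx k n).
Variables (H : algType k) (t : 'I_n -> 'I_n -> H).
Hypothesis t_RTT : forall i j p l,
  \sum_a \sum_b R i a j b *: (t a p * t b l) =
  \sum_a \sum_b R a p b l *: (t j b * t i a).
Hypothesis t_ext : spanned_by_words t.
Variables (Delta : H -> H ⊗m H) (eps : H -> k).
Hypothesis bialg : bialgebra Delta eps.
Hypothesis Delta_t : forall i j, Delta (t i j) = \sum_a t i a ⊗ t a j.
Hypothesis eps_t : forall i j, eps (t i j) = (i == j)%:R.

Let DL : linear Delta := Delta_linear bialg.
Let eL : scalar eps := eps_linear bialg.
Local Notation mult := (mult_mx Delta eps).
Local Notation pairing := (pairing Delta eps).
Local Notation W := (@wmx n H t _).

Let mT : mult t. Proof. by []. Qed.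
Let mW N : mult (@wmx n H t N).
Proof.
exact: mult_wmx (Delta1 bialg) (DeltaM bialg) Delta_t (eps1 bialg)
  (epsM bialg) eps_t N.
Qed.

(** Two inductions: on the word in the second argument of r against a single generator, then on the
    word in the first argument. Each step cancels an inner pair of crossings by [sum_sandwich]. *)
Lemma pairing_inverse (r s : H -> H -> k) : pairing r -> pairing s ->
  (forall i j p q, \sum_a \sum_b r (t i a) (t p b) * s (t b q) (t a j) =
                   (i == j)%:R * (p == q)%:R) ->
  forall N (x y : widx n N) N' (u v : widx n N'),
  \sum_z \sum_w r (wmx t x z) (wmx t u w) * s (wmx t w v) (wmx t z y) =
  (x == y)%:R * (u == v)%:R.
Proof.
move=> hr hs rs_t.
have rs1 i j N' (u v : widx n N') :
    \sum_z \sum_w r (t i z) (wmx t u w) * s (wmx t w v) (t z j) =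
    (i == j)%:R * (u == v)%:R.
  elim: N' => [|N' IH] in i j u v *.
    rewrite exchange_big sum_unit /=.
    under eq_bigr do rewrite (pairing1r hr) (pairing1l hs) !eps_t.
    by rewrite sum_kid; case: u v => [] []; rewrite mulr1.
  rewrite exchange_big sum_pair /=.
  under eq_bigr do under eq_bigr do under eq_bigr do
    rewrite (pairingMr hr mT) (pairingMl hs mT).
  (* The inner pair belongs to the first letter of the word and is cancelled by [rs_t]; the outer
     pair is the induction hypothesis. *)
  rewrite (sum_sandwich (d := (u.1 == v.1)%:R)
    (fun p w' => r (t i p) (wmx t u.2 w'))
    (fun q w' => s (wmx t w' v.2) (t q j))
    (f2 := fun p w z => r (t p z) (t u.1 w))
    (g2 := fun q w z => s (t w v.1) (t z q))).
    by rewrite IH mulrCA; congr (_ * _); rewrite (kid_pair _ u v).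
  by move=> p q; rewrite exchange_big rs_t.
move=> N x y N' u v; elim: N => [|N IH] in x y u v *.
  rewrite sum_unit /=.
  under eq_bigr do rewrite (pairing1l hr) (pairing1r hs) !(mW _).2.
  by rewrite sum_kid; case: x y => [] []; rewrite mul1r.
rewrite sum_pair exchange_big /=.
under eq_bigr do under eq_bigr do under eq_bigr do
  rewrite (pairingMl hr (mW _)) (pairingMr hs (mW _)).
(* Now the inner pair belongs to the tail of the word and is cancelled by induction; the outer pair,
   for the first letter, is [rs1]. *)
rewrite (sum_sandwich (d := (x.2 == y.2)%:R)
  (fun p z => r (t x.1 z) (wmx t u p)) (fun q z => s (wmx t q v) (t z y.1))
  (f2 := fun p z' w => r (wmx t x.2 z') (wmx t p w))
  (g2 := fun q z' w => s (wmx t w q) (wmx t z' y.2))).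
  rewrite exchange_big rs1 mulrA (kid_pair _ x y).
  by rewrite [_%:R * (x.1 == _)%:R]mulrC.
by move=> p q; rewrite IH mulrC.
Qed.

Definition commutes_at (r : H -> H -> k) (X Y : finType) (T : X -> X -> H)
  (S : Y -> Y -> H) : Prop := forall x y u v,
  \sum_z \sum_w r (T z y) (S w v) *: (S u w * T x z) =
  \sum_z \sum_w r (T x z) (S u w) *: (T z y * S w v).

(** On two generators this is the RTT relation. [zipper] carries it to words in the second argument,
    then to words in the first. *)
Lemma pairing_comm (r : H -> H -> k) : pairing r ->
  (forall i j p q, r (t i j) (t p q) = R i j p q) ->
  forall N N', commutes_at r (@wmx n H t N) (@wmx n H t N').
Proof.
move=> hr r_t.
have mulB := alg_mul_bilinear H.
have comm1 N' : commutes_at r t (@wmx n H t N').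
  elim: N' => [|N' IH] x y u v.
    under eq_bigr => z _ do rewrite sum_unit /= (pairing1r hr) eps_t.
    under [RHS]eq_bigr => z _ do rewrite sum_unit /= (pairing1r hr) eps_t.
    rewrite (bigD1 y) //= eqxx scale1r big1 ?addr0; last first.
      by move=> z /negPf ->; rewrite scale0r.
    rewrite (bigD1 x) //= eqxx scale1r big1 ?addr0; last first.
      by move=> z /negPf; rewrite eq_sym => ->; rewrite scale0r.
    by rewrite mul1r mulr1.
  rewrite exchange_big sum_pair exchange_big /=.
  rewrite [RHS]exchange_big [RHS]sum_pair [RHS]exchange_big /=.
  under eq_bigr do under eq_bigr do under eq_bigr do rewrite (pairingMr hr mT).
  under [RHS]eq_bigr do under eq_bigr do under eq_bigr do
    rewrite (pairingMr hr mT).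
  (* The pairing reverses products in its second argument, so the strand [t x] passes the tail of
     the word before its first letter: [zipper] runs on the opposite product. *)
  apply: (zipper (op := fun a b => b * a) _ _
    (f := fun w' z p => r (t z p) (wmx t w' v.2))
    (f' := fun w p => r (t p y) (t w v.1))
    (g := fun w' z => r (t x z) (wmx t u.2 w'))
    (g' := fun w z p => r (t z p) (t u.1 w))
    (s := t x) (s2 := t) (s3 := t ^~ y)
    (u := wmx t u.2) (u2 := fun w' => wmx t w' v.2)
    (u' := t u.1) (u2' := t ^~ v.1)).
  - by split=> z; [exact: mulB.2|exact: mulB.1].
  - by move=> a b d; rewrite mulrA.
  - by move=> p; rewrite exchange_big IH exchange_big.
  (* The crossing of two generators: r takes the values R there. *)
  move=> z; rewrite exchange_big.
  under eq_bigr do under eq_bigr do rewrite r_t.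
  under [RHS]eq_bigr do under eq_bigr do rewrite r_t.
  by rewrite -t_RTT [RHS]exchange_big.
elim=> [|N IH] N' x y u v.
  rewrite !sum_unit /=.
  under eq_bigr do rewrite (pairing1l hr) (mW _).2.
  under [RHS]eq_bigr do rewrite (pairing1l hr) (mW _).2.
  rewrite (bigD1 v) //= eqxx scale1r big1 ?addr0; last first.
    by move=> z /negPf ->; rewrite scale0r.
  rewrite (bigD1 u) //= eqxx scale1r big1 ?addr0; last first.
    by move=> z /negPf; rewrite eq_sym => ->; rewrite scale0r.
  by rewrite mul1r mulr1.
rewrite sum_pair [RHS]sum_pair /=.
under eq_bigr do under eq_bigr do under eq_bigr do
  rewrite (pairingMl hr (mW N')).
under [RHS]eq_bigr do under eq_bigr do under eq_bigr do
  rewrite (pairingMl hr (mW N')).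
exact: (zipper mulB (@mulrA H)
  (f := fun z w q => r (t z y.1) (wmx t w q))
  (f' := fun z' q => r (wmx t z' y.2) (wmx t q v))
  (g := fun z w => r (t x.1 z) (wmx t u w))
  (g' := fun z' w q => r (wmx t x.2 z') (wmx t w q))
  (s := wmx t u) (s2 := @wmx n H t N') (s3 := fun q => wmx t q v)
  (u := t x.1) (u2 := t ^~ y.1)
  (u' := wmx t x.2) (u2' := fun z' => wmx t z' y.2)
  (fun q => comm1 _ _ _ _ _) (fun w => IH _ _ _ _ _)).
Qed.

Lemma bilin_scale (U : lmodType k) (f : H -> H -> k) (g : H -> H -> U) :
  bilinear_for *:%R *:%R (f : H -> H -> k^o) -> bilinear_for *:%R *:%R g ->
  (forall b1 b2, bilinear_for *:%R *:%R (fun a1 a2 => f a1 b1 *: g a2 b2)) /\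
  (forall a1 a2, bilinear_for *:%R *:%R (fun b1 b2 => f a1 b1 *: g a2 b2)).
Proof.
move=> [fl fr] [gl gr]; split=> d d'; split=> z a x y /=.
- by have /= -> := fl d a x y; rewrite scalerDl scalerA.
- by have /= -> := gl d' a x y; rewrite scalerDr !scalerA mulrC.
- by have /= -> := fr d a x y; rewrite scalerDl scalerA.
- by have /= -> := gr d' a x y; rewrite scalerDr !scalerA mulrC.
Qed.

Lemma bilin_flip (U : lmodType k) (f : H -> H -> U) :
  bilinear_for *:%R *:%R f -> bilinear_for *:%R *:%R (fun a b => f b a).
Proof. by move=> [fl fr]; split=> z; [exact: fr|exact: fl]. Qed.

(** The axioms are linear in each argument, which reduces them to word entries; there they are
    [pairing_inverse], the product rules of a pairing and [pairing_comm]. *)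
Lemma pairing_dual_quasitriangular (r s : H -> H -> k) :
  pairing r -> pairing s ->
  (forall i j p q, r (t i j) (t p q) = R i j p q) ->
  (forall i j p q, \sum_a \sum_b r (t i a) (t p b) * s (t b q) (t a j) =
                   (i == j)%:R * (p == q)%:R) ->
  (forall i j p q, \sum_a \sum_b s (t i a) (t p b) * r (t b q) (t a j) =
                   (i == j)%:R * (p == q)%:R) ->
  dual_quasitriangular Delta eps.
Proof.
move=> hr hs r_t rs_t sr_t.
have rB := pairing_bilin hr; have sB := bilin_flip (pairing_bilin hs).
have mulB := alg_mul_bilinear H.
have [rho rhoL rhoE] : exists2 rho : H ⊗m H -> k, scalar rho &
    forall a b, rho (a ⊗ b) = r a b.
  by exists (tlift (r : H -> H -> k^o));
    [exact: tlift_linear rB|exact: tliftE rB].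
(* The convolution inverse is s with its arguments exchanged. *)
have [rho' rhoL' rhoE'] : exists2 rho' : H ⊗m H -> k, scalar rho' &
    forall a b, rho' (a ⊗ b) = s b a.
  by exists (tlift (fun a b => s b a : k^o));
    [exact: tlift_linear sB|exact: tliftE sB].
exists rho; split=> //.
- exists rho' => //.
  have [B1 B2] := bilin_scale rB sB; have [B3 B4] := bilin_scale sB rB.
  have lin_eps (x : k) : linear (fun b => x * eps b : k^o).
    by move=> a u v; rewrite eL mulrDr mulrCA.
  have lin_eps' (x : k) : linear (fun b => eps b * x : k^o).
    by move=> a u v; rewrite eL mulrDl -mulrA.
  have conv_rs a b : conv Delta rho rho' a b =
      sweedler2 Delta (fun a1 a2 b1 b2 => r a1 b1 *: (s b2 a2 : k^o)) a b.
    rewrite /conv /sweedler2; apply: (eq_tlift (U := k^o)) => a1 a2.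
    apply: (eq_tlift (U := k^o)) => b1 b2.
    by rewrite rhoE rhoE'.
  have conv_sr a b : conv Delta rho' rho a b =
      sweedler2 Delta (fun a1 a2 b1 b2 => s b1 a1 *: (r a2 b2 : k^o)) a b.
    rewrite /conv /sweedler2; apply: (eq_tlift (U := k^o)) => a1 a2.
    apply: (eq_tlift (U := k^o)) => b1 b2.
    by rewrite rhoE rhoE'.
  move=> a b; rewrite conv_rs conv_sr; split.
    move: a; apply: (t_ext (U := k^o)) => [||N x y].
    + exact: sweedler2_linear_l.
    + exact: lin_eps'.
    move: b; apply: (t_ext (U := k^o)) => [||N' u v].
    + exact: sweedler2_linear_r.
    + exact: lin_eps.
    rewrite (sweedler2_mult_mx B1 B2 _ _ _ _ (mW N) (mW N')) !(mW _).2.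
    exact: pairing_inverse hr hs rs_t _ _ _ _ _ _.
  move: a; apply: (t_ext (U := k^o)) => [||N x y].
  + exact: sweedler2_linear_l.
  + exact: lin_eps'.
  move: b; apply: (t_ext (U := k^o)) => [||N' u v].
  + exact: sweedler2_linear_r.
  + exact: lin_eps.
  (* For the product in the other order, [pairing_inverse] is used with r and s, and with the two
     words, in exchanged roles. *)
  rewrite (sweedler2_mult_mx B3 B4 _ _ _ _ (mW N) (mW N')) !(mW _).2 mulrC.
  rewrite exchange_big; exact: pairing_inverse hs hr sr_t _ _ _ _ _ _.
- move=> a b d; rewrite rhoE.
  under eq_tlift do rewrite !rhoE.
  have B : bilinear_for *:%R *:%R (fun c1 c2 => r a c1 * r b c2 : k^o).
    split=> z x u v /=.
      by have /= -> := rB.2 a x u v; rewrite mulrDl -mulrA.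
    by have /= -> := rB.2 b x u v; rewrite mulrDr mulrCA.
  move: d; apply: (t_ext (U := k^o)) => [||N u v].
  + exact: rB.2.
  + exact: lin_comp (tlift_linear B) DL.
  by rewrite (tlift_mult_mx _ _ B (mW N)) (pairingMl hr (mW N)).
- move=> d a b; rewrite rhoE.
  under eq_tlift do rewrite !rhoE.
  have B : bilinear_for *:%R *:%R (fun a1 a2 => r a1 b * r a2 a : k^o).
    split=> z x u v /=.
      by have /= -> := rB.1 b x u v; rewrite mulrDl -mulrA.
    by have /= -> := rB.1 a x u v; rewrite mulrDr mulrCA.
  move: d; apply: (t_ext (U := k^o)) => [||N u v].
  + exact: rB.1.
  + exact: lin_comp (tlift_linear B) DL.
  by rewrite (tlift_mult_mx _ _ B (mW N)) (pairingMr hr (mW N)).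
have [B1 B2] := bilin_scale rB (bilin_flip mulB).
have [B3 B4] := bilin_scale rB mulB.
pose E1 (a1 a2 b1 b2 : H) : H := r a2 b2 *: (b1 * a1).
pose E2 (a1 a2 b1 b2 : H) : H := r a1 b1 *: (a2 * b2).
have B5 b1 b2 : bilinear_for *:%R *:%R (fun a1 a2 => E1 a1 a2 b1 b2).
  exact: bilin_flip (B1 _ _).
have B6 a1 a2 : bilinear_for *:%R *:%R (E1 a1 a2) by exact: bilin_flip (B2 _ _).
suff E a b : sweedler2 Delta E1 a b = sweedler2 Delta E2 a b.
  by move=> a b; apply: etrans (etrans (E a b) _);
    apply: eq_tlift => a1 a2; apply: eq_tlift => b1 b2; rewrite rhoE.
move: a; apply: t_ext => [||N x y]; [exact: sweedler2_linear_l..|].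
move: b; apply: t_ext => [||N' u v]; [exact: sweedler2_linear_r..|].
rewrite (sweedler2_mult_mx B5 B6 _ _ _ _ (mW N) (mW N')).
rewrite (sweedler2_mult_mx B3 B4 _ _ _ _ (mW N) (mW N')).
exact: pairing_comm.
Qed.

End DualQuasitriangular.

(** * Identities between R-matrices *)

Section RMatrixIdentities.
Variables (k : fieldType) (n : nat).
Implicit Types A B C : tensor_mx k n.
Local Notation I3 := ('I_n * 'I_n * 'I_n)%type.

Lemma mulkAE (X Y Z W : finType) (f : X -> Y -> k) (g : Y -> Z -> k)
  (h : Z -> W -> k) : mulk f (mulk g h) = mulk (mulk f g) h.
Proof. by apply/funext => x; apply/funext => w; exact: mulkA. Qed.

Lemma mulk1lE (X Y : finType) (f : X -> Y -> k) : mulk (@kid k X) f = f.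
Proof. by apply/funext => x; apply/funext => y; exact: mulk1l. Qed.

Lemma mulk1rE (X Y : finType) (f : X -> Y -> k) : mulk f (@kid k Y) = f.
Proof. by apply/funext => x; apply/funext => y; exact: mulk1r. Qed.

Lemma mulk_invM (X : finType) (a b a' b' : X -> X -> k) :
  mulk a' a = @kid k X -> mulk b' b = @kid k X ->
  mulk (mulk b' a') (mulk a b) = @kid k X.
Proof. by move=> Ea Eb; rewrite -mulkAE (mulkAE a') Ea mulk1lE. Qed.

(** The device that turns the relations satisfied by R into relations satisfied by its inverse. *)
Lemma mulk_intertwine_inv (X Y : finType) (u u' : X -> X -> k)
  (v v' : Y -> Y -> k) (f : X -> Y -> k) :
  mulk u f = mulk f v -> mulk u' u = @kid k X -> mulk v v' = @kid k Y ->
  mulk f v' = mulk u' f.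
Proof.
move=> E Eu Ev; rewrite -[f in RHS]mulk1rE -Ev (mulkAE f) -E -mulkAE.
by rewrite (mulkAE u') Eu mulk1lE.
Qed.

(** In this and the following formulas the identity on the untouched strand is summed away. What
    remains are the sums occurring in [pairing_data]. *)
Lemma mulk_R12 (X : finType) (f : X -> I3 -> k) A x y :
  mulk f (R12 A) x y = \sum_a \sum_b f x (a, b, y.2) * A a y.1.1 b y.1.2.
Proof.
rewrite /mulk !sum_pair; apply: eq_bigr => a _; apply: eq_bigr => b _.
by under eq_bigr do rewrite /R12 /= mulrA; rewrite sum_kidr.
Qed.

Lemma mulk_R13 (X : finType) (f : X -> I3 -> k) A x y :
  mulk f (R13 A) x y = \sum_a \sum_s f x (a, y.1.2, s) * A a y.1.1 s y.2.
Proof.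
rewrite /mulk !sum_pair; apply: eq_bigr => a _.
rewrite exchange_big; apply: eq_bigr => s _.
by under eq_bigr do rewrite /R13 /= mulrA; rewrite sum_kidr.
Qed.

Lemma mulk_R23 (X : finType) (f : X -> I3 -> k) A x y :
  mulk f (R23 A) x y = \sum_b \sum_s f x (y.1.1, b, s) * A b y.1.2 s y.2.
Proof.
rewrite /mulk !sum_pair exchange_big; apply: eq_bigr => b _.
rewrite exchange_big; apply: eq_bigr => s _.
by under eq_bigr do rewrite /R23 /= mulrA; rewrite sum_kidr.
Qed.

Lemma R12_mulk (Y : finType) A (f : I3 -> Y -> k) x y :
  mulk (R12 A) f x y = \sum_a \sum_b A x.1.1 a x.1.2 b * f (a, b, x.2) y.
Proof.
rewrite /mulk !sum_pair; apply: eq_bigr => a _; apply: eq_bigr => b _.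
by under eq_bigr do rewrite /R12 /= -mulrA mulrCA; rewrite sum_kid.
Qed.

Lemma R23_mulk (Y : finType) A (f : I3 -> Y -> k) x y :
  mulk (R23 A) f x y = \sum_b \sum_s A x.1.2 b x.2 s * f (x.1.1, b, s) y.
Proof.
rewrite /mulk !sum_pair exchange_big; apply: eq_bigr => b _.
rewrite exchange_big; apply: eq_bigr => s _.
by under eq_bigr do rewrite /R23 /= -mulrA mulrCA; rewrite sum_kid.
Qed.

Lemma sum_kid_mid (I : finType) (f g : I -> k) i :
  \sum_j f j * (i == j)%:R * g j = f i * g i.
Proof.
by rewrite -[RHS](sum_kid (fun j => f j * g j)); apply: eq_bigr => j _;
  rewrite -mulrA mulrCA.
Qed.

Section Products.
Variables (A B C : tensor_mx k n) (x1 x2 x3 y1 y2 y3 : 'I_n).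
Let x : I3 := (x1, x2, x3).
Let y : I3 := (y1, y2, y3).

Lemma mulk_R12_R13 : mulk (R12 A) (R13 B) x y =
  \sum_a A x1 a x2 y2 * B a y1 x3 y3.
Proof.
rewrite mulk_R13; apply: eq_bigr => a _ /=.
by under eq_bigr do rewrite /R12 /=; rewrite sum_kid_mid.
Qed.

Lemma mulk_R13_R12 : mulk (R13 A) (R12 B) x y =
  \sum_a A x1 a x3 y3 * B a y1 x2 y2.
Proof.
rewrite mulk_R12; apply: eq_bigr => a _ /=.
by under eq_bigr do rewrite /R13 /=; rewrite sum_kid_mid.
Qed.

Lemma mulk_R13_R23 : mulk (R13 A) (R23 B) x y =
  \sum_s A x1 y1 x3 s * B x2 y2 s y3.
Proof.
rewrite mulk_R23 exchange_big; apply: eq_bigr => s _ /=.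
by under eq_bigr do rewrite /R13 /=; rewrite sum_kid_mid.
Qed.

Lemma mulk_R23_R13 : mulk (R23 A) (R13 B) x y =
  \sum_s A x2 y2 x3 s * B x1 y1 s y3.
Proof.
rewrite mulk_R13 exchange_big; apply: eq_bigr => s _ /=.
by under eq_bigr do rewrite /R23 /=; rewrite sum_kid_mid.
Qed.

End Products.

Section Inverse.
Variables (A B : tensor_mx k n).
Hypothesis AB : mulk (op2 A) (op2 B) =2 @kid k _.

Let ABE x1 x2 y1 y2 :
  \sum_a \sum_b A x1 a x2 b * B a y1 b y2 = (x1 == y1)%:R * (x2 == y2)%:R.
Proof.
by have := AB (x1, x2) (y1, y2); rewrite /mulk sum_pair /kid kid_pair.
Qed.

Lemma mulk_R12V : mulk (R12 A) (R12 B) = @kid k _.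
Proof.
apply/funext => -[[x1 x2] x3]; apply/funext => -[[y1 y2] y3].
rewrite mulk_R12 /R12 /=; under eq_bigr do under eq_bigr do rewrite mulrAC.
under eq_bigr do rewrite -mulr_suml.
by rewrite -mulr_suml ABE /kid !kid_pair.
Qed.

Lemma mulk_R13V : mulk (R13 A) (R13 B) = @kid k _.
Proof.
apply/funext => -[[x1 x2] x3]; apply/funext => -[[y1 y2] y3].
rewrite mulk_R13 /R13 /=; under eq_bigr do under eq_bigr do rewrite mulrAC.
under eq_bigr do rewrite -mulr_suml.
by rewrite -mulr_suml ABE /kid !kid_pair /= mulrAC.
Qed.

Lemma mulk_R23V : mulk (R23 A) (R23 B) = @kid k _.
Proof.
apply/funext => -[[x1 x2] x3]; apply/funext => -[[y1 y2] y3].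
rewrite mulk_R23 /R23 /=; under eq_bigr do under eq_bigr do rewrite mulrAC.
under eq_bigr do rewrite -mulr_suml.
by rewrite -mulr_suml ABE /kid !kid_pair /= mulrC mulrA.
Qed.

End Inverse.

End RMatrixIdentities.

(** * Admissibility of R and of its flipped inverse *)

Section PairingData.
Variables (k : fieldType) (n : nat) (R R' : tensor_mx k n).
Variable (c : 'I_n -> 'I_n -> 'I_n -> k).
Hypothesis RV : mulk (op2 R) (op2 R') =2 @kid k _.
Hypothesis VR : mulk (op2 R') (op2 R) =2 @kid k _.
Hypothesis YB : mulk (mulk (R12 R) (R13 R)) (R23 R) =
                mulk (mulk (R23 R) (R13 R)) (R12 R).
Hypothesis functorial_l : forall i j p m q,
  \sum_a c i j a * R p a m q =
  \sum_a \sum_b c a b p * (\sum_s R a i m s * R b j s q).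
Hypothesis functorial_r : forall i j p m q,
  \sum_a c i j a * R m q p a =
  \sum_a \sum_b c a b p * (\sum_s R m s b j * R s q a i).
Local Notation I3 := ('I_n * 'I_n * 'I_n)%type.

(** Both RTT conditions are entries of the Yang-Baxter equation: R acts on strands 1, 2 or on
    strands 2, 3, and the remaining strand carries m and q. The conditions on c are the two
    functoriality identities. *)
Lemma pairing_data_R : pairing_data R c R.
Proof.
split=> // i j p l m q.
  have := congr1 (fun f : I3 -> I3 -> k => f (i, j, m) (p, l, q)) YB.
  rewrite -mulkAE R12_mulk mulk_R12 /= => E; apply: etrans (etrans E _);
    apply: eq_bigr => a _; apply: eq_bigr => b _.
    by rewrite mulk_R13_R23.
  by rewrite mulk_R23_R13 mulrC.
have := congr1 (fun f : I3 -> I3 -> k => f (m, i, j) (q, p, l)) YB.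
rewrite -[in RHS]mulkAE R23_mulk mulk_R23 /= => /esym E.
apply: etrans (etrans E _); apply: eq_bigr => a _; apply: eq_bigr => b _.
  by rewrite mulk_R13_R12.
by rewrite mulk_R12_R13 mulrC.
Qed.

(* R_21^{-1} *)
Definition flipV : tensor_mx k n := fun i j p q => R' p q i j.

(** The Yang-Baxter equation says that R_23 intertwines R_12 R_13 with R_13 R_12, hence also their
    inverses; [YBr] is the analogue for R_12. *)
Let YBl : mulk (R23 R) (mulk (R12 R') (R13 R')) =
          mulk (mulk (R13 R') (R12 R')) (R23 R).
Proof.
apply: (mulk_intertwine_inv (u := mulk (R12 R) (R13 R))
  (v := mulk (R13 R) (R12 R))); first by rewrite YB mulkAE.
  exact: mulk_invM (mulk_R12V VR) (mulk_R13V VR).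
exact: mulk_invM (mulk_R12V RV) (mulk_R13V RV).
Qed.

Let YBr : mulk (R12 R) (mulk (R23 R') (R13 R')) =
          mulk (mulk (R13 R') (R23 R')) (R12 R).
Proof.
apply: (mulk_intertwine_inv (u := mulk (R23 R) (R13 R))
  (v := mulk (R13 R) (R23 R))); first by rewrite -YB mulkAE.
  exact: mulk_invM (mulk_R23V VR) (mulk_R13V VR).
exact: mulk_invM (mulk_R23V RV) (mulk_R13V RV).
Qed.

(** The product of the algebra applied to the first two of three strands; [Cr] applies it to the
    last two. *)
Let Cl (x : 'I_n * 'I_n) (y : I3) : k := c y.1.1 y.1.2 x.1 * (x.2 == y.2)%:R.
Let Cr (x : 'I_n * 'I_n) (y : I3) : k := c y.1.2 y.2 x.2 * (x.1 == y.1.1)%:R.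

Let op2_Cl A p m i j q :
  mulk (op2 A) Cl (p, m) (i, j, q) = \sum_a c i j a * A p a m q.
Proof.
rewrite /mulk sum_pair; apply: eq_bigr => a _.
by under eq_bigr do rewrite /Cl /= mulrA; rewrite sum_kidr mulrC.
Qed.

Let op2_Cr A m p q i j :
  mulk (op2 A) Cr (m, p) (q, i, j) = \sum_a c i j a * A m q p a.
Proof.
rewrite /mulk sum_pair exchange_big; apply: eq_bigr => a _.
by under eq_bigr do rewrite /Cr /= mulrA; rewrite sum_kidr mulrC.
Qed.

Let Cl_mulk (f : I3 -> I3 -> k) p m y :
  mulk Cl f (p, m) y = \sum_a \sum_b c a b p * f (a, b, m) y.
Proof.
rewrite /mulk !sum_pair; apply: eq_bigr => a _; apply: eq_bigr => b _.
by under eq_bigr do rewrite /Cl /= -mulrA mulrCA; rewrite sum_kid.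
Qed.

Let Cr_mulk (f : I3 -> I3 -> k) m p y :
  mulk Cr f (m, p) y = \sum_a \sum_b c a b p * f (m, a, b) y.
Proof.
rewrite /mulk !sum_pair exchange_big; apply: eq_bigr => a _.
rewrite exchange_big; apply: eq_bigr => b _.
by under eq_bigr do rewrite /Cr /= -mulrA mulrCA; rewrite sum_kid.
Qed.

Let op2V : mulk (op2 R') (op2 R) = @kid k _.
Proof. by apply/funext => x; apply/funext => y; exact: VR. Qed.

(** Functoriality says that [Cl] intertwines R with R_13 R_23, so it intertwines the inverses as
    well; likewise [CrV] with R_13 R_12. *)
Let ClV : mulk (op2 R') Cl = mulk Cl (mulk (R23 R') (R13 R')).
Proof.
have E : mulk (op2 R) Cl = mulk Cl (mulk (R13 R) (R23 R)).
  apply/funext => -[p m]; apply/funext => -[[i j] q].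
  rewrite op2_Cl Cl_mulk functorial_l; apply: eq_bigr => a _.
  by apply: eq_bigr => b _; rewrite mulk_R13_R23.
apply/esym/(mulk_intertwine_inv E op2V).
exact: mulk_invM (mulk_R23V RV) (mulk_R13V RV).
Qed.

Let CrV : mulk (op2 R') Cr = mulk Cr (mulk (R12 R') (R13 R')).
Proof.
have E : mulk (op2 R) Cr = mulk Cr (mulk (R13 R) (R12 R)).
  apply/funext => -[m p]; apply/funext => -[[q i] j].
  rewrite op2_Cr Cr_mulk functorial_r; apply: eq_bigr => a _.
  by apply: eq_bigr => b _; rewrite mulk_R13_R12.
apply/esym/(mulk_intertwine_inv E op2V).
exact: mulk_invM (mulk_R12V RV) (mulk_R13V RV).
Qed.

(** The flip moves the strand carrying m and q to the opposite end: the conditions on the first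
    factor come from [YBl] and [CrV], those on the second from [YBr] and [ClV]. *)
Lemma pairing_data_flipV : pairing_data R c flipV.
Proof.
split=> [i j p l m q|i j p m q|i j p l m q|i j p m q].
- have := congr1 (fun f : I3 -> I3 -> k => f (m, i, j) (q, p, l)) YBl.
  rewrite R23_mulk mulk_R23 /= => E; apply: etrans (etrans E _);
    apply: eq_bigr => a _; apply: eq_bigr => b _.
    by rewrite mulk_R12_R13.
  by rewrite mulk_R13_R12 mulrC.
- have := congr1 (fun f => f (m, p) (q, i, j)) CrV.
  rewrite op2_Cr Cr_mulk => E; apply: etrans E _.
  by apply: eq_bigr => a _; apply: eq_bigr => b _; rewrite mulk_R12_R13.
- have := congr1 (fun f : I3 -> I3 -> k => f (i, j, m) (p, l, q)) YBr.
  rewrite R12_mulk mulk_R12 /= => E; apply: etrans (etrans E _);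
    apply: eq_bigr => a _; apply: eq_bigr => b _.
    by rewrite mulk_R23_R13.
  by rewrite mulk_R13_R23 mulrC.
have := congr1 (fun f => f (p, m) (i, j, q)) ClV.
rewrite op2_Cl Cl_mulk => E; apply: etrans E _.
by apply: eq_bigr => a _; apply: eq_bigr => b _; rewrite mulk_R23_R13.
Qed.

End PairingData.

(** * Functoriality of the braiding in components *)

Section BraidingComponents.
Variables (k : fieldType) (A : vectType k).
Variables (mu : {linear A ⊗m A -> A}) (Psi : {linear A ⊗m A -> A ⊗m A}).
Variables (n : nat) (e : n.-tuple A).
Variables (c : 'I_n -> 'I_n -> 'I_n -> k) (R : tensor_mx k n).
Hypothesis he : basis_of fullv e.
Hypothesis hc : forall i j : 'I_n,
  mu (e`_i ⊗ e`_j) = \sum_(p < n) c i j p *: e`_p.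
Hypothesis hPsi : forall i j : 'I_n,
  Psi (e`_i ⊗ e`_j) = \sum_(a < n) \sum_(b < n) R a i b j *: (e`_b ⊗ e`_a).
Hypothesis hA : braided_algebra mu Psi.

Let Psi12L : linear (Psi12 Psi) := tmap_linear Psi idfun.
Let Psi23L : linear (Psi23 Psi).
Proof.
exact: lin_comp (@tassocV_linear _ _ _ _)
  (lin_comp (tmap_linear idfun Psi) (@tassoc_linear _ _ _ _)).
Qed.

Let Psi12E (i j : 'I_n) (z : A) : Psi12 Psi (e`_i ⊗ e`_j ⊗ z) =
  \sum_a \sum_b R a i b j *: (e`_b ⊗ e`_a ⊗ z).
Proof.
rewrite /Psi12 tmapE hPsi.
exact: (lin_sumZ2 ((tens_bilinear _ _).1 (idfun z)) (fun a b => R a i b j)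
  (fun a b : 'I_n => e`_b ⊗ e`_a)).
Qed.

Let Psi23E (z : A) (i j : 'I_n) : Psi23 Psi (z ⊗ e`_i ⊗ e`_j) =
  \sum_a \sum_b R a i b j *: (z ⊗ e`_b ⊗ e`_a).
Proof.
rewrite /Psi23 tassocE tmapE hPsi.
have zL : linear (fun y => tassocV ((idfun z : A) ⊗ (y : A ⊗m A))).
  exact: lin_comp (@tassocV_linear _ _ _ _) ((tens_bilinear _ _).2 z).
apply: etrans (lin_sumZ2 zL (fun a b => R a i b j)
  (fun a b : 'I_n => e`_b ⊗ e`_a)) _.
by apply: eq_bigr => a _; apply: eq_bigr => b _; rewrite tassocVE.
Qed.

(** The form reading off the coefficient of e_p ⊗ e_q. *)
Let xi (p q : 'I_n) (x : A ⊗m A) : k :=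
  \tsum_(u, v <- x) (coord e p u * coord e q v : k^o).

Let xi_bilin (p q : 'I_n) :
  bilinear_for *:%R *:%R (fun u v => coord e p u * coord e q v : k^o).
Proof.
split=> z a x y; rewrite linearP /=; first by rewrite mulrDl -mulrA.
by rewrite mulrDr mulrCA.
Qed.

Let xiL p q : linear (xi p q : A ⊗m A -> k^o) := tlift_linear (xi_bilin p q).

Let xiE p q u v : xi p q (u ⊗ v) = coord e p u * coord e q v.
Proof. exact: (tliftE (xi_bilin p q)). Qed.

Let coord_e (p i : 'I_n) : coord e p e`_i = (p == i)%:R.
Proof. by rewrite (coord_free _ _ (basis_free he)) eq_sym. Qed.

Let coord_mu (p i j : 'I_n) : coord e p (mu (e`_i ⊗ e`_j)) = c i j p.
Proof.
rewrite hc linear_sum /=; under eq_bigr do rewrite linearZ /= coord_e.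
by under eq_bigr do rewrite eq_sym; rewrite sum_kidr.
Qed.

(** The order q, p is due to R^a_i^b_j being the coefficient of e_b ⊗ e_a. *)
Let xi_Psi (p q i j : 'I_n) : xi q p (Psi (e`_i ⊗ e`_j)) = R p i q j.
Proof.
rewrite hPsi (scalar_sumZ2 (xiL q p) (fun a b => R a i b j)).
under eq_bigr => a _.
  under eq_bigr => b _ do rewrite xiE !coord_e mulrCA.
  rewrite sum_kid.
over.
by under eq_bigr do rewrite mulrC; rewrite sum_kid.
Qed.

Let xi_Psi_mul_l (i j p m q : 'I_n) :
  xi m p (Psi (mu (e`_i ⊗ e`_j) ⊗ e`_q)) = \sum_a c i j a * R p a m q.
Proof.
have L : linear (fun x => xi m p (Psi (x ⊗ e`_q)) : k^o).
  exact: lin_comp (xiL m p) (lin_comp (linearP Psi) ((tens_bilinear _ _).1 _)).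
rewrite hc; apply: etrans (scalar_sumZ L (c i j) (fun a : 'I_n => e`_a)) _.
by apply: eq_bigr => a _; rewrite xi_Psi.
Qed.

Let xi_Psi_mul_r (i j p m q : 'I_n) :
  xi p m (Psi (e`_q ⊗ mu (e`_i ⊗ e`_j))) = \sum_a c i j a * R m q p a.
Proof.
have L : linear (fun x => xi p m (Psi (e`_q ⊗ x)) : k^o).
  exact: lin_comp (xiL p m) (lin_comp (linearP Psi) ((tens_bilinear _ _).2 _)).
rewrite hc; apply: etrans (scalar_sumZ L (c i j) (fun a : 'I_n => e`_a)) _.
by apply: eq_bigr => a _; rewrite xi_Psi.
Qed.

(** Comparison of the coefficients of e_m ⊗ e_p in [braided_mull] at e_i, e_j, e_q. *)
Lemma braided_components_l i j p m q :
  \sum_a c i j a * R p a m q =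
  \sum_a \sum_b c a b p * (\sum_s R a i m s * R b j s q).
Proof.
rewrite -xi_Psi_mul_l (braided_mull hA) Psi23E.
pose G x : k^o := xi m p (tmap idfun mu (tassoc x)).
have GL : linear G.
  exact: lin_comp (xiL m p)
    (lin_comp (tmap_linear idfun mu) (@tassoc_linear _ _ _ _)).
have GE (u v w : 'I_n) : G (e`_u ⊗ e`_v ⊗ e`_w) = (m == u)%:R * c v w p.
  by rewrite /G tassocE tmapE xiE coord_e coord_mu.
rewrite -/(G _) (scalar_sumZ2 (lin_comp GL Psi12L) (fun b s => R b j s q)
  (fun b s : 'I_n => e`_i ⊗ e`_s ⊗ e`_b)).
rewrite [RHS]exchange_big; apply: eq_bigr => b _.
under [RHS]eq_bigr do rewrite mulr_sumr.
rewrite [RHS]exchange_big; apply: eq_bigr => s _.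
rewrite Psi12E (scalar_sumZ2 GL (fun a u => R a i u s)
  (fun a u : 'I_n => e`_u ⊗ e`_a ⊗ e`_b)) mulr_sumr.
apply: eq_bigr => a _; under eq_bigr do rewrite GE mulrCA.
by rewrite sum_kid mulrC -mulrA mulrCA.
Qed.

(** Comparison of the coefficients of e_p ⊗ e_m in [braided_mulr] at e_q, e_i, e_j. *)
Lemma braided_components_r i j p m q :
  \sum_a c i j a * R m q p a =
  \sum_a \sum_b c a b p * (\sum_s R m s b j * R s q a i).
Proof.
rewrite -xi_Psi_mul_r (braided_mulr hA) Psi12E.
pose G x : k^o := xi p m (tmap mu idfun x).
have GL : linear G by exact: lin_comp (xiL p m) (tmap_linear mu idfun).
have GE (u v w : 'I_n) : G (e`_u ⊗ e`_v ⊗ e`_w) = c u v p * (m == w)%:R.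
  by rewrite /G tmapE xiE coord_e coord_mu.
rewrite -/(G _) (scalar_sumZ2 (lin_comp GL Psi23L) (fun s a => R s q a i)
  (fun s a : 'I_n => e`_a ⊗ e`_s ⊗ e`_j)).
rewrite exchange_big; apply: eq_bigr => a _.
under [RHS]eq_bigr do rewrite mulr_sumr.
rewrite [RHS]exchange_big; apply: eq_bigr => s _.
rewrite Psi23E (scalar_sumZ2 GL (fun u b => R u s b j)
  (fun u b : 'I_n => e`_a ⊗ e`_b ⊗ e`_u)) exchange_big mulr_sumr.
apply: eq_bigr => b _; under eq_bigr do rewrite GE mulrA mulrC.
by rewrite sum_kid mulrC -mulrA mulrCA.
Qed.

End BraidingComponents.

Theorem proposition4p1 (k : fieldType) (A : vectType k)
    (mu : {linear A ⊗m A -> A}) (Psi : {linear A ⊗m A -> A ⊗m A})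
    (n : nat) (e : n.-tuple A)
    (c : 'I_n -> 'I_n -> 'I_n -> k) (R : tensor_mx k n)
    (he : basis_of fullv e)
    (hc : forall i j : 'I_n, mu (e`_i ⊗ e`_j) = \sum_(p < n) c i j p *: e`_p)
    (hPsi : forall i j : 'I_n,
       Psi (e`_i ⊗ e`_j) = \sum_(a < n) \sum_(b < n) R a i b j *: (e`_b ⊗ e`_a))
    (hA : braided_algebra mu Psi)
    (hYB : yang_baxter R) (hinv : tensor_mx_invertible R) :
  exists (Delta : M1 R c -> M1 R c ⊗m M1 R c) (eps : M1 R c -> k),
    [/\ bialgebra Delta eps,
        forall i j, Delta (M1_gen R c i j) =
          \sum_(a < n) M1_gen R c i a ⊗ M1_gen R c a j,
        forall i j, eps (M1_gen R c i j) = (i == j)%:R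
      & dual_quasitriangular Delta eps].
Proof.
have [R' [RV' VR']] := hinv.
have RV : mulk (op2 R) (op2 R') =2 @kid k _ by exact: RV'.
have VR : mulk (op2 R') (op2 R) =2 @kid k _ by exact: VR'.
have YB : mulk (mulk (R12 R) (R13 R)) (R23 R) =
          mulk (mulk (R23 R) (R13 R)) (R12 R).
  by apply/funext => x; apply/funext => y; exact: hYB.
have Fl := braided_components_l he hc hPsi hA.
have Fr := braided_components_r he hc hPsi hA.
have t_RTT := @M1_RTT k n R c; have t_alg := @M1_alg k n R c.
have t_ext : spanned_by_words (M1_gen R c) by exact: M1_ext.
have t_lift : M1_universal (M1_gen R c) R c by exact: M1_lift.
have [Delta [eps [bialg Dt et]]] := exists_bialgebra t_RTT t_alg t_ext t_lift.
exists Delta, eps; split=> //.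
have [r hr r_t] := exists_pairing t_ext t_lift bialg Dt et
  (pairing_data_R YB Fl Fr).
have [s hs s_t] := exists_pairing t_ext t_lift bialg Dt et
  (pairing_data_flipV RV VR YB Fl Fr).
apply: (pairing_dual_quasitriangular t_RTT t_ext bialg Dt et hr hs r_t) =>
  i j p q.
  under eq_bigr do under eq_bigr do rewrite r_t s_t.
  by have := RV (i, p) (j, q); rewrite /mulk sum_pair /kid kid_pair.
under eq_bigr do under eq_bigr do rewrite r_t s_t.
(* As s takes the values of the flipped inverse, this is R^{-1} R = 1 with the two tensor factors
   exchanged. *)
rewrite exchange_big mulrC.
by have := VR (p, i) (q, j); rewrite /mulk sum_pair /kid kid_pair.
Qed.
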